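(* Let $q\in\mathbb{N}$, $m\in\mathbb{N}_{0}$ and $a,b\in\mathbb{R}$ with $a<b$. Let $\chi$ be a Dirichlet character modulo $q$ and let $f(t)$ be an $m+1$ times continuously differentiable (real- or complex-valued) function on the interval $[a,b]$. Then, for every $\lambda\in\mathbb{C}\setminus\{0\}$, $$\sum_{\substack{a<k\leqslant b\\k\in\mathbb{Z}}}\chi(k)\lambda^{-k}f(k)=\sum_{k=0}^{m}\frac{(-1)^{k+1}}{(k+1)!}\Bigl(\beta_{k+1,\chi^{-}}(\{b\}_{\chi},\lambda)f^{(k)}(b)-\beta_{k+1,\chi^{-}}(\{a\}_{\chi},\lambda)f^{(k)}(a)\Bigr)+\delta_{1,\lambda^{q}}\,\beta_{0,\chi^{-}}(\lambda)\int_{a}^{b}f(t)\,dt+\frac{(-1)^{m}}{(m+1)!}\int_{a}^{b}\beta_{m+1,\chi^{-}}(\{t\}_{\chi},\lambda)f^{(m+1)}(t)\,dt,$$ where $$\beta_{0,\chi^{-}}(\lambda)=\frac{1}{q}\sum_{r=1}^{q}\chi(-r)\lambda^{r}$$ and, for $j\in\mathbb{N}$ and $x\in\mathbb{R}$, $$\beta_{j,\chi^{-}}(\{x\}_{\chi},\lambda)=q^{j-1}\sum_{r=1}^{q}\chi(-r)\lambda^{r-q\left[\frac{x+r}{q}\right]}\beta_{j}\Bigl(\Bigl\{\frac{x+r}{q}\Bigr\},\lambda^{q}\Bigr).$$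
   Context: $\mathbb{N}$ is the set of positive integers and $\mathbb{N}_0$ the set of non-negative integers. For $x\in\mathbb{R}$, $[x]$ is the integer part (floor) and $\{x\}=x-[x]\in[0,1)$ the fractional part. $\delta_{s,z}=1$ if $s=z$ and $0$ otherwise. A Dirichlet character modulo $q$ is extended to $\mathbb{Z}$ in the usual way (zero on integers not coprime to $q$); for $q=1$ it is identically $1$, in particular $\chi(0)=1$. The symbol $\beta_{j,\chi^-}(\{x\}_\chi,\lambda)$ is a single piece of notation for the function of $x$ defined in the claim. $f^{(k)}$ is the $k$-th derivative of $f$ (one-sided at the endpoints). The Apostol-Bernoulli polynomials $\beta_n(x,\mu)$, for $\mu\in\mathbb{C}\setminus\{0\}$ and $n\in\mathbb{N}_0$, are defined by the Taylor expansion at $t=0$ $$\frac{te^{xt}}{\mu e^{t}-1}=\sum_{n=0}^{\infty}\beta_{n}(x,\mu)\frac{t^{n}}{n!}$$ (with the removable singularity at $t=0$ filled in when $\mu=1$). *)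

(* Defs.v *)
From Stdlib Require Import Reals ZArith List Lra Lia.
From Coquelicot Require Import Coquelicot.

Open Scope R_scope.

Definition Cexp (z : C) : C := (RtoC (exp (Re z)) * (cos (Im z), sin (Im z)))%C.

Definition Cpowz (z : C) (n : Z) : C :=
  match n with
  | Z0 => RtoC 1
  | Zpos p => Cpow z (Pos.to_nat p)
  | Zneg p => Cinv (Cpow z (Pos.to_nat p))
  end.

(** [chi 1 = 1] follows from multiplicativity and [chi 1 <> 0].  For [q = 1]
    every integer, including 0, is coprime to [q], so that [chi] is constantly
    1. *)
Definition is_dirichlet_character (q : nat) (chi : Z -> C) : Prop :=
  (forall m n : Z, chi (m * n)%Z = (chi m * chi n)%C) /\
  (forall n : Z, chi (n + Z.of_nat q)%Z = chi n) /\
  (forall n : Z, chi n <> RtoC 0 <-> Z.gcd n (Z.of_nat q) = 1%Z).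

(** [B n] is the value at [x] of the [n]-th Apostol-Bernoulli polynomial with
    parameter [mu].  The expansion is required on a punctured disk; the value
    filled in at [t = 0] is then the sum of the power series there. *)
Definition is_apostol_bernoulli (x mu : C) (B : nat -> C) : Prop :=
  exists r : posreal, forall t : C, t <> RtoC 0 -> Cmod t < r ->
    is_pseries (K := C_AbsRing) (V := C_NormedModule)
      (fun n => (B n / RtoC (INR (fact n)))%C) t
      (t * Cexp (x * t) / (mu * Cexp t - RtoC 1))%C.

Definition apostol_bernoulli (n : nat) (x mu : C) : C :=
  iota (T := C_R_CompleteNormedModule)
    (fun c => exists B : nat -> C, is_apostol_bernoulli x mu B /\ B n = c).

Definition beta0_chi (q : nat) (chi : Z -> C) (lambda : C) : C :=
  (RtoC (/ INR q) *
   sum_n_m (G := C_AbelianMonoid)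
     (fun r => chi (- Z.of_nat r)%Z * lambda ^ r) 1 q)%C.

(** Meaningful for [1 <= j] only; the case [j = 0] is [beta0_chi]. *)
Definition beta_chi (q : nat) (chi : Z -> C) (j : nat) (x : R) (lambda : C) : C :=
  (RtoC (INR q ^ (j - 1))%R *
   sum_n_m (G := C_AbelianMonoid)
     (fun r =>
        let y := ((x + INR r) / INR q)%R in
        chi (- Z.of_nat r)%Z
        * Cpowz lambda (Z.of_nat r - Z.of_nat q * Int_part y)
        * apostol_bernoulli j (RtoC (frac_part y)) (lambda ^ q))
     1 q)%C.

Definition Cdelta (s z : C) : C := if Ceq_dec s z then RtoC 1 else RtoC 0.

Definition Zrange_oc (a b : R) : list Z :=
  map (fun i => (Int_part a + Z.of_nat i)%Z)
      (seq 1 (Z.to_nat (Int_part b - Int_part a))).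

Lemma Zrange_oc_In (a b : R) (k : Z) :
  In k (Zrange_oc a b) <-> a < IZR k <= b.
Proof.
  destruct (base_Int_part a) as [a1 a2], (base_Int_part b) as [b1 b2].
  assert (Ha : a < IZR k <-> (Int_part a < k)%Z).
  { split; intros H.
    - apply lt_IZR; lra.
    - assert (H1 : (Int_part a + 1 <= k)%Z) by lia.
      apply IZR_le in H1; rewrite plus_IZR in H1; lra. }
  assert (Hb : IZR k <= b <-> (k <= Int_part b)%Z).
  { split; intros H.
    - assert (H1 : (k < Int_part b + 1)%Z)
        by (apply lt_IZR; rewrite plus_IZR; lra).
      lia.
    - apply IZR_le in H; lra. }
  rewrite Ha, Hb; unfold Zrange_oc; rewrite in_map_iff; split.
  - intros [i [<- Hi]]; apply in_seq in Hi; lia.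
  - intros H; exists (Z.to_nat (k - Int_part a)); rewrite in_seq; lia.
Qed.

Lemma Zrange_oc_NoDup (a b : R) : NoDup (Zrange_oc a b).
Proof.
  apply NoDup_map_NoDup_ForallPairs; [ | apply seq_NoDup ].
  intros i j _ _ H; lia.
Qed.

Definition sum_Z_oc (a b : R) (F : Z -> C) : C :=
  fold_right Cplus (RtoC 0) (map F (Zrange_oc a b)).

(** Derivatives within [[a, b]], hence one-sided at the endpoints. *)
Definition is_derive_on (a b : R) (f : R -> C) (x : R) (l : C) : Prop :=
  filterdiff (K := R_AbsRing) (U := R_NormedModule) (V := C_R_NormedModule) f
    (within (fun y => a <= y <= b) (locally x)) (fun y => scal y l).

Definition Derive_on (a b : R) (f : R -> C) (x : R) : C :=
  iota (T := C_R_CompleteNormedModule) (is_derive_on a b f x).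

Fixpoint Derive_n_on (a b : R) (f : R -> C) (n : nat) : R -> C :=
  match n with
  | O => f
  | S k => Derive_on a b (Derive_n_on a b f k)
  end.

Definition is_Cn_on (a b : R) (n : nat) (f : R -> C) : Prop :=
  (forall (k : nat) (x : R), (k < n)%nat -> a <= x <= b ->
     exists l : C, is_derive_on a b (Derive_n_on a b f k) x l) /\
  continuous_on (U := C_R_NormedModule) (fun x => a <= x <= b) (Derive_n_on a b f n).

Definition C_RInt (f : R -> C) (a b : R) : C :=
  RInt (V := C_R_CompleteNormedModule) f a b.

(* Main.v *)
Require Import Defs.
From Stdlib Require Import Reals ZArith Lia Lra.
From Coquelicot Require Import Coquelicot.
Open Scope R_scope.
Open Scope C_scope.

(** Write [mu = lambda ^ q].  Expanding [t e^(xt) / (mu e^t - 1)] as the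
    product of [e^(xt)] and [t / (mu e^t - 1)] gives the normalized polynomials
    [d_n (x) = beta_n (x, mu) / n!] ([apostol_polynomials]).  Three facts about
    them suffice: [d_0] is the constant [delta_(1, mu)], [d_(n+1)' = d_n], and
    [mu d_n (1) - d_n (0)] is [1] for [n = 1] and [0] for every other [n].  The
    last one compares the coefficients of the generating functions at [x = 1]
    and [x = 0], whose combination is just [t].

    On an interval [n, n+1) with integer endpoints all the floors
    [[(x + r) / q]] are constant, so there [beta_(j, chi^-) ({x}_chi, lambda)]
    is [j!] times a polynomial [w_(j, n)] ([chi_weight]).  In [j] these satisfy
    [w_(j+1, n)' = w_(j, n)] ([chi_weight_derivative]), starting at the constant
    [c = delta beta_0] ([chi_weight_0]).  Between consecutive intervals only the
    weight with [j = 1] jumps: at the integer [n] the argument [(x + r) / q] of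
    exactly one residue [r] reaches an integer, and the jump is
    [chi (n) lambda ^ (- n)] ([chi_weight_jump]).

    The formula is then Euler-Maclaurin summation ([euler_maclaurin]).  The
    function [Psi n = sum_(k <= m) (-1)^k w_(k+1, n) f^(k)] has a telescoping
    derivative, namely [c f + (-1)^m w_(m+1, n) f^(m+1)]; integrating it over
    each unit interval and adding up leaves the boundary terms at [a] and [b]
    and one jump [chi (n) lambda ^ (- n) f (n)] for each integer [n] in
    [(a, b]].

    Two analytic preliminaries support this.  A power series with nonzero
    constant term and bounded coefficients has a reciprocal with geometrically
    bounded coefficients ([Cseries_inverse]), so [t / (mu e^t - 1)] is analytic
    near [0].  And a [C^N] function on [[a, b]], with one-sided derivatives at
    the endpoints, is the restriction of a [C^N] function on the line
    ([is_Cn_on_extension]), so that two-sided calculus applies throughout. *)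

(** * Complex series, componentwise *)

Lemma C_ext (z w : C) : Re z = Re w -> Im z = Im w -> z = w.
Proof. destruct z, w; simpl; congruence. Qed.

(** Sums and limits state equalities in the carrier of an algebraic structure
    that is only convertible to [C]; [ring] and [field] need the type [C]
    itself. *)
Ltac Ceq := cbv beta; lazymatch goal with |- @eq _ ?a ?b => change (@eq C a b) end.
Ltac Cring := Ceq; ring.

Notation Csum := (sum_n (G := C_AbelianMonoid)).
Notation Cseries := (is_series (K := C_AbsRing) (V := C_NormedModule)).

Lemma Csum_components (a : nat -> C) (n : nat) :
  Csum a n = (sum_n (fun k => Re (a k)) n, sum_n (fun k => Im (a k)) n).
Proof.
  induction n as [|n IH].
  - now rewrite !sum_O, <- surjective_pairing.
  - now rewrite !sum_Sn, IH.
Qed.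

Lemma Cseries_components (a : nat -> C) (l : C) :
  Cseries a l <->
  is_series (fun n => Re (a n)) (Re l) /\ is_series (fun n => Im (a n)) (Im l).
Proof.
  unfold is_series; split.
  - intros H; split.
    + apply filterlim_ext with (fun n => fst (Csum a n)).
      { intros n; now rewrite Csum_components. }
      eapply filterlim_comp; [exact H|].
      apply (continuous_fst (U := R_UniformSpace) (V := R_UniformSpace) (Re l) (Im l)).
    + apply filterlim_ext with (fun n => snd (Csum a n)).
      { intros n; now rewrite Csum_components. }
      eapply filterlim_comp; [exact H|].
      apply (continuous_snd (U := R_UniformSpace) (V := R_UniformSpace) (Re l) (Im l)).
  - intros [H1 H2].
    apply filterlim_ext with
      (fun n => (sum_n (fun k => Re (a k)) n, sum_n (fun k => Im (a k)) n)).
    { intros n; now rewrite Csum_components. }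
    destruct l as [x y].
    intros P [eps HP].
    generalize (H1 _ (locally_ball (T := R_UniformSpace) x eps))
      (H2 _ (locally_ball (T := R_UniformSpace) y eps)).
    unfold filtermap; intros A B.
    generalize (filter_and _ _ A B); apply filter_imp.
    intros n [P1 P2]; apply HP; split; assumption.
Qed.

Lemma Re_Csum (a : nat -> C) (n : nat) : Re (Csum a n) = sum_n (fun k => Re (a k)) n.
Proof. now rewrite Csum_components. Qed.

Lemma Im_Csum (a : nat -> C) (n : nat) : Im (Csum a n) = sum_n (fun k => Im (a k)) n.
Proof. now rewrite Csum_components. Qed.

Lemma im_le_Cmod (z : C) : (Rabs (Im z) <= Cmod z)%R.
Proof.
  eapply Rle_trans; [|apply Rmax_Cmod]; apply Rmax_r.
Qed.

Lemma ex_series_Rabs_Cmod (a : nat -> C) (u : nat -> R) :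
  (forall n, (Rabs (u n) <= Cmod (a n))%R) ->
  ex_series (fun n => Cmod (a n)) -> ex_series (fun n => Rabs (u n)).
Proof.
  intros H; apply (ex_series_le (V := R_CompleteNormedModule)).
  intros n; change (Rabs (Rabs (u n)) <= Cmod (a n))%R.
  now rewrite Rabs_Rabsolu.
Qed.

Lemma sum_n_Rminus (u v : nat -> R) (n : nat) :
  (sum_n u n - sum_n v n = sum_n (fun k => (u k - v k)%R) n)%R.
Proof.
  induction n as [|n IH]; [now rewrite !sum_O|].
  rewrite !sum_Sn, <- IH; unfold plus; simpl; ring.
Qed.

Lemma Cseries_cauchy_product (a b : nat -> C) (la lb : C) :
  Cseries a la -> Cseries b lb ->
  ex_series (fun n => Cmod (a n)) -> ex_series (fun n => Cmod (b n)) ->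
  Cseries (fun n => Csum (fun k => a k * b (n - k)%nat) n) (la * lb).
Proof.
  intros Ha Hb Aa Ab.
  apply Cseries_components in Ha as [Ra Ia].
  apply Cseries_components in Hb as [Rb Ib].
  assert (Xra := ex_series_Rabs_Cmod a _ (fun n => re_le_Cmod (a n)) Aa).
  assert (Xia := ex_series_Rabs_Cmod a _ (fun n => im_le_Cmod (a n)) Aa).
  assert (Xrb := ex_series_Rabs_Cmod b _ (fun n => re_le_Cmod (b n)) Ab).
  assert (Xib := ex_series_Rabs_Cmod b _ (fun n => im_le_Cmod (b n)) Ab).
  apply Cseries_components; split.
  - rewrite re_mult.
    eapply is_series_ext;
      [|exact (is_series_minus _ _ _ _ (is_series_mult _ _ _ _ Ra Rb Xra Xrb)
                 (is_series_mult _ _ _ _ Ia Ib Xia Xib))].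
    intros n; cbv beta; rewrite Re_Csum, <- !sum_n_Reals.
    etransitivity; [apply sum_n_Rminus|]; apply sum_n_ext; intros k.
    symmetry; apply re_mult.
  - rewrite im_mult.
    eapply is_series_ext;
      [|exact (is_series_plus _ _ _ _ (is_series_mult _ _ _ _ Ra Ib Xra Xib)
                 (is_series_mult _ _ _ _ Ia Rb Xia Xrb))].
    intros n; cbv beta; rewrite Im_Csum, <- !sum_n_Reals.
    rewrite <- sum_n_plus; apply sum_n_ext; intros k.
    symmetry; apply im_mult.
Qed.

(** * The exponential series *)

Definition expterm (n : nat) (z : C) : C := z ^ n / RtoC (INR (fact n)).

Lemma fact_C_neq_0 (n : nat) : RtoC (INR (fact n)) <> 0.
Proof. intros H; apply RtoC_inj in H; exact (INR_fact_neq_0 n H). Qed.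

Lemma S_C_neq_0 (n : nat) : RtoC (INR (S n)) <> 0.
Proof. intros H; apply RtoC_inj in H; exact (not_0_INR (S n) (Nat.neq_succ_0 n) H). Qed.

Lemma expterm_0 (z : C) : expterm 0 z = 1.
Proof. unfold expterm; simpl; field. Qed.

Lemma expterm_S (n : nat) (z : C) :
  RtoC (INR (S n)) * expterm (S n) z = z * expterm n z.
Proof.
  unfold expterm; rewrite fact_simpl, mult_INR, RtoC_mult, Cpow_S.
  field; split; [apply fact_C_neq_0 | apply S_C_neq_0].
Qed.

Lemma Cmod_expterm (n : nat) (z : C) : Cmod (expterm n z) = (Cmod z ^ n / INR (fact n))%R.
Proof.
  unfold expterm; rewrite Cmod_div by apply fact_C_neq_0.
  rewrite Cmod_pow, Cmod_R, Rabs_pos_eq; [reflexivity | apply pos_INR].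
Qed.

Lemma ex_series_Cmod_expterm (z : C) : ex_series (fun n => Cmod (expterm n z)).
Proof.
  exists (exp (Cmod z)).
  eapply is_series_ext; [|apply (proj1 (is_pseries_R _ _ _) (is_exp_Reals (Cmod z)))].
  intros n; rewrite Cmod_expterm; simpl; unfold Rdiv; ring.
Qed.

Lemma Csum_scal_l (c : C) (a : nat -> C) (n : nat) :
  Csum (fun k => c * a k) n = c * Csum a n.
Proof. exact (sum_n_mult_l (K := C_Ring) c a n). Qed.

Lemma Csum_Sn (a : nat -> C) (n : nat) : Csum a (S n) = Csum a n + a (S n).
Proof. exact (sum_Sn a n). Qed.

Lemma Csum_0n (a : nat -> C) (n : nat) :
  Csum a (S n) = a 0%nat + Csum (fun k => a (S k)) n.
Proof.
  unfold sum_n; rewrite sum_n_m_S.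
  apply (sum_Sn_m (G := C_AbelianMonoid)); lia.
Qed.

(** The binomial theorem in the form needed for [e^z e^w = e^(z+w)].  Since
    [n e_n (z) = z e_(n-1) (z)] for [e_n (z) = z^n / n!], both sides multiplied
    by [n] obey the same recursion once [n] is split as [k + (n - k)]. *)
Lemma expterm_plus (z w : C) (n : nat) :
  Csum (fun k => expterm k z * expterm (n - k)%nat w) n = expterm n (z + w).
Proof.
  induction n as [|n IH].
  { rewrite sum_O, Nat.sub_diag, !expterm_0. apply Cmult_1_l. }
  assert (H : RtoC (INR (S n)) * Csum (fun k => expterm k z * expterm (S n - k)%nat w) (S n)
           = RtoC (INR (S n)) * expterm (S n) (z + w)).
  2:{ rewrite <- (Cmult_1_l (Csum _ _)), <- (Cmult_1_l (expterm (S n) _)).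
      rewrite <- (Cinv_l _ (S_C_neq_0 n)), <- !Cmult_assoc, H; reflexivity. }
  rewrite expterm_S, <- IH, Cmult_plus_distr_r.
  rewrite <- !Csum_scal_l.
  transitivity
    (Csum (fun k => RtoC (INR k) * expterm k z * expterm (S n - k)%nat w) (S n)
     + Csum (fun k => RtoC (INR (S n - k)) * expterm k z * expterm (S n - k)%nat w) (S n)).
  - etransitivity; [|apply (sum_n_plus (G := C_AbelianMonoid))].
    apply sum_n_ext_loc; intros k Hk.
    change (RtoC (INR (S n)) * (expterm k z * expterm (S n - k) w) =
       RtoC (INR k) * expterm k z * expterm (S n - k) w +
       RtoC (INR (S n - k)) * expterm k z * expterm (S n - k) w).
    rewrite minus_INR, RtoC_minus by lia; ring.
  - f_equal.
    + rewrite Csum_0n. change (INR 0) with 0%R.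
      rewrite (sum_n_ext _ (fun k => z * (expterm k z * expterm (n - k) w))).
      2:{ intros k; rewrite expterm_S; simpl (S n - S k)%nat; Cring. }
      Cring.
    + rewrite Csum_Sn, Nat.sub_diag; change (INR 0) with 0%R.
      rewrite (sum_n_ext_loc _ (fun k => w * (expterm k z * expterm (n - k) w))).
      2:{ intros k Hk; rewrite Nat.sub_succ_l by lia.
          rewrite <- Cmult_assoc, (Cmult_comm (expterm k z)), Cmult_assoc, expterm_S; Cring. }
      Cring.
Qed.

Lemma Cseries_exp_real (x : R) : Cseries (fun n => expterm n (RtoC x)) (RtoC (exp x)).
Proof.
  assert (E : forall n, expterm n (RtoC x) = RtoC (/ INR (fact n) * x ^ n)%R).
  { intros n; unfold expterm.
    rewrite RtoC_mult, RtoC_pow, RtoC_inv by apply INR_fact_neq_0.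
    field; apply fact_C_neq_0. }
  apply Cseries_components; split.
  - eapply is_series_ext; [|apply (proj1 (is_pseries_R _ _ _) (is_exp_Reals x))].
    intros n; rewrite E; reflexivity.
  - apply is_series_ext with (fun _ => 0%R); [intros n; now rewrite E|].
    apply is_series_Reals; intros eps Heps; exists 0%nat; intros n _.
    rewrite (sum_eq_R0 (fun _ => 0%R)) by reflexivity.
    now rewrite R_dist_eq.
Qed.

(** Taylor coefficients of [y |-> e^(i y)], real at even and imaginary at odd
    indices. *)
Definition exp_i_coef (n : nat) : C := Ci ^ n / RtoC (INR (fact n)).

Lemma Ci_pow_even (n : nat) : Ci ^ (2 * n) = RtoC ((-1) ^ n).
Proof.
  rewrite Cpow_mult_r, RtoC_pow; f_equal.
  apply C_ext; simpl; ring.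
Qed.

Lemma exp_i_coef_even (n : nat) :
  exp_i_coef (2 * n) = RtoC (cos_n n).
Proof.
  unfold exp_i_coef, cos_n; rewrite Ci_pow_even, <- RtoC_div by apply INR_fact_neq_0.
  reflexivity.
Qed.

Lemma exp_i_coef_odd (n : nat) :
  exp_i_coef (2 * n + 1) = Ci * RtoC (sin_n n).
Proof.
  unfold exp_i_coef, sin_n; rewrite Cpow_add_r, Ci_pow_even, RtoC_div by apply INR_fact_neq_0.
  rewrite Cpow_1_r; field; apply fact_C_neq_0.
Qed.

Lemma is_pseries_cos (x : R) : is_pseries (fun n => cos_n n) (x ^ 2)%R (cos x).
Proof.
  apply is_pseries_R, is_series_Reals.
  unfold cos; destruct (exist_cos (Rsqr x)) as [l Hl].
  replace (x ^ 2)%R with (Rsqr x) by (unfold Rsqr; ring); exact Hl.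
Qed.

Lemma is_pseries_sin (x : R) : exists s : R,
  is_pseries (fun n => sin_n n) (x ^ 2)%R s /\ sin x = (x * s)%R.
Proof.
  unfold sin; destruct (exist_sin (Rsqr x)) as [l Hl].
  exists l; split; [|reflexivity].
  apply is_pseries_R, is_series_Reals.
  replace (x ^ 2)%R with (Rsqr x) by (unfold Rsqr; ring); exact Hl.
Qed.

Lemma is_pseries_0_R (x : R) (a : nat -> R) :
  (forall n, a n = 0%R) -> is_pseries a x 0%R.
Proof.
  intros H; apply is_pseries_R, is_series_Reals; intros eps Heps; exists 0%nat; intros n _.
  rewrite (sum_eq_R0 (fun n => a n * x ^ n)%R) by (intros k _; rewrite H; ring).
  now rewrite R_dist_eq.
Qed.

Lemma Cseries_exp_imag (y : R) :
  Cseries (fun n => expterm n (Ci * RtoC y)) (cos y, sin y).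
Proof.
  assert (E : forall n, expterm n (Ci * RtoC y) = exp_i_coef n * RtoC (y ^ n)).
  { intros n; unfold expterm, exp_i_coef; rewrite Cpow_mult_l, RtoC_pow.
    field; apply fact_C_neq_0. }
  destruct (is_pseries_sin y) as [s [Hs Es]].
  apply Cseries_components; split.
  - change (Re (cos y, sin y)) with (cos y).
    apply is_series_ext with (fun n => Re (exp_i_coef n) * y ^ n)%R.
    { intros n; rewrite E, re_scal_r; reflexivity. }
    apply is_pseries_R.
    replace (cos y) with (cos y + y * 0)%R by ring.
    apply is_pseries_odd_even.
    + apply is_pseries_ext with (fun n => cos_n n); [|apply is_pseries_cos].
      intros n; now rewrite exp_i_coef_even.
    + apply is_pseries_0_R; intros n; rewrite exp_i_coef_odd; simpl; ring.
  - change (Im (cos y, sin y)) with (sin y).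
    apply is_series_ext with (fun n => Im (exp_i_coef n) * y ^ n)%R.
    { intros n; rewrite E, im_scal_r; reflexivity. }
    apply is_pseries_R.
    replace (sin y) with (0 + y * s)%R by (rewrite Es; ring).
    apply is_pseries_odd_even.
    + apply is_pseries_0_R; intros n; now rewrite exp_i_coef_even.
    + apply is_pseries_ext with (fun n => sin_n n); [|exact Hs].
      intros n; rewrite exp_i_coef_odd; simpl; ring.
Qed.

(** [Cexp] is defined by its polar form, so the series is obtained as the
    product of those of [e^(Re z)] and [e^(i Im z)]. *)
Lemma Cseries_exp (z : C) : Cseries (fun n => expterm n z) (Cexp z).
Proof.
  unfold Cexp.
  eapply is_series_ext;
    [|exact (Cseries_cauchy_product _ _ _ _ (Cseries_exp_real (Re z)) (Cseries_exp_imag (Im z))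
        (ex_series_Cmod_expterm _) (ex_series_Cmod_expterm _))].
  intros n; cbv beta; rewrite expterm_plus; f_equal.
  apply C_ext; simpl; ring.
Qed.

(** * Uniqueness of power series *)

(** Agreement is assumed off [0] only.  Multiplying both series by [t] makes
    them agree at [0] as well, and shifts the coefficients by one. *)
Lemma real_power_series_unique (a b : nat -> R) (r : R) :
  (0 < r)%R ->
  (forall t : R, (0 < Rabs t < r)%R ->
     exists l, is_pseries a t l /\ is_pseries b t l) ->
  forall n, a n = b n.
Proof.
  intros Hr H n.
  assert (Hex : forall c, (forall t : R, (0 < Rabs t < r)%R -> ex_pseries c t) ->
     Rbar_lt 0 (CV_radius c)).
  { intros c Hc.
    assert (Hx : Rabs (r / 2) = (r / 2)%R) by (apply Rabs_pos_eq; lra).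
    apply Rbar_lt_le_trans with (r / 2)%R; [simpl; lra|].
    apply Rbar_not_lt_le; intros Hlt; rewrite <- Hx in Hlt.
    apply (CV_disk_outside c _ Hlt), ex_series_lim_0.
    destruct (Hc (r / 2)%R) as [l Hl]; [lra|].
    exists l; now apply is_pseries_R. }
  change (PS_incr_1 a (S n) = PS_incr_1 b (S n)).
  apply PSeries_ext_recip.
  - rewrite CV_radius_incr_1; apply Hex.
    intros t Ht; destruct (H t Ht) as [l Hl]; exists l; apply Hl.
  - rewrite CV_radius_incr_1; apply Hex.
    intros t Ht; destruct (H t Ht) as [l Hl]; exists l; apply Hl.
  - exists (mkposreal r Hr); intros t Ht.
    change (Rabs (t - 0) < r)%R in Ht; rewrite Rminus_0_r in Ht.
    rewrite !PSeries_incr_1.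
    destruct (Req_dec t 0) as [->|Ht0]; [ring|].
    destruct (H t) as [l [Ha Hb]]; [split; [now apply Rabs_pos_lt|exact Ht]|].
    now rewrite (is_pseries_unique _ _ _ Ha), (is_pseries_unique _ _ _ Hb).
Qed.

(** Real values of [t] suffice: there the real and imaginary parts are real
    power series. *)
Lemma C_power_series_unique (a b : nat -> C) (r : R) :
  (0 < r)%R ->
  (forall t : C, t <> 0 -> (Cmod t < r)%R ->
     exists l, Cseries (fun n => a n * t ^ n) l /\ Cseries (fun n => b n * t ^ n) l) ->
  forall n, a n = b n.
Proof.
  intros Hr H n.
  assert (H' : forall t : R, (0 < Rabs t < r)%R -> exists l,
    Cseries (fun n => a n * RtoC (t ^ n)) l /\ Cseries (fun n => b n * RtoC (t ^ n)) l).
  { intros t Ht; destruct (H (RtoC t)) as [l [Ha Hb]].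
    - intros E; apply RtoC_inj in E; rewrite E, Rabs_R0 in Ht; lra.
    - rewrite Cmod_R; apply Ht.
    - exists l; split.
      + eapply is_series_ext; [|exact Ha]; intros k; now rewrite RtoC_pow.
      + eapply is_series_ext; [|exact Hb]; intros k; now rewrite RtoC_pow. }
  apply C_ext; revert n; apply (real_power_series_unique _ _ r Hr);
    intros t Ht; destruct (H' t Ht) as [l [Ha Hb]];
    apply Cseries_components in Ha as [Ra Ia];
    apply Cseries_components in Hb as [Rb Ib].
  - exists (Re l); split; apply is_pseries_R.
    + eapply is_series_ext; [|exact Ra]; intros n; apply re_scal_r.
    + eapply is_series_ext; [|exact Rb]; intros n; apply re_scal_r.
  - exists (Im l); split; apply is_pseries_R.
    + eapply is_series_ext; [|exact Ia]; intros n; apply im_scal_r.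
    + eapply is_series_ext; [|exact Ib]; intros n; apply im_scal_r.
Qed.

(** * Reciprocal of a power series *)

(** The coefficients of [1 / a] satisfy a course-of-values recursion;
    [inv_table a n] tabulates the first [n + 1] of them so that the recursion is
    structural. *)
Fixpoint inv_table (a : nat -> C) (n : nat) : nat -> C :=
  match n with
  | O => fun _ => / a 0%nat
  | S m => fun k =>
      if (k <=? m)%nat then inv_table a m k
      else - / a 0%nat * Csum (fun j => a (S j) * inv_table a m (m - j)%nat) m
  end.

Definition inv_coef (a : nat -> C) (n : nat) : C := inv_table a n n.

Lemma inv_table_stable (a : nat -> C) (n k : nat) :
  (k <= n)%nat -> inv_table a n k = inv_coef a k.
Proof.
  induction n as [|n IH]; intros Hk.
  - now replace k with 0%nat by lia.
  - destruct (Nat.eq_dec k (S n)) as [->|Hne]; [reflexivity|].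
    simpl; rewrite (proj2 (Nat.leb_le k n)) by lia; apply IH; lia.
Qed.

Lemma inv_coef_S (a : nat -> C) (n : nat) :
  inv_coef a (S n) = - / a 0%nat * Csum (fun j => a (S j) * inv_coef a (n - j)%nat) n.
Proof.
  unfold inv_coef at 1; cbn [inv_table].
  rewrite (proj2 (Nat.leb_gt (S n) n)) by lia.
  f_equal; apply sum_n_ext_loc; intros k Hk; now rewrite inv_table_stable by lia.
Qed.

Lemma inv_coef_convolution (a : nat -> C) (n : nat) :
  a 0%nat <> 0 ->
  Csum (fun k => a k * inv_coef a (n - k)%nat) n = (if n then RtoC 1 else RtoC 0).
Proof.
  intros Ha; destruct n as [|n].
  - rewrite sum_O; change (inv_coef a (0 - 0)%nat) with (/ a 0%nat); Ceq; now field.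
  - rewrite Csum_0n, Nat.sub_0_r, inv_coef_S; simpl (S n - S _)%nat.
    Ceq; field; exact Ha.
Qed.

Lemma Csum_norm_le (a : nat -> C) (u : nat -> R) (n : nat) :
  (forall k, (k <= n)%nat -> (Cmod (a k) <= u k)%R) ->
  (Cmod (Csum a n) <= sum_n u n)%R.
Proof.
  induction n as [|n IH]; intros H.
  - rewrite !sum_O; apply H; lia.
  - rewrite Csum_Sn, sum_Sn; eapply Rle_trans; [apply Cmod_triangle|].
    apply Rplus_le_compat; [apply IH; intros; apply H; lia | apply H; lia].
Qed.

(** The geometric sum in the summation order produced by a convolution; the
    factor [L - 1] avoids excluding [L = 1]. *)
Lemma geometric_sum_rev (L : R) (n : nat) :
  ((L - 1) * sum_n (fun j => L ^ (n - j)) n = L ^ S n - 1)%R.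
Proof.
  induction n as [|n IH]; [rewrite sum_O; simpl; ring|].
  assert (E : sum_n (fun j => L ^ (S n - j))%R (S n)
              = (L ^ S n + sum_n (fun j => L ^ (n - j))%R n)%R).
  { unfold sum_n; rewrite sum_Sn_m, <- sum_n_m_S by lia; reflexivity. }
  rewrite E, Rmult_plus_distr_l, IH; simpl; ring.
Qed.

(** The ratio [L = 1 + A / |a_0|] is the one for which the induction closes:
    the recursion gives [|c_(n+1)| <= (1 / |a_0|) sum_j (L - 1) L^(n-j)], and
    that sum is [L^(n+1) - 1]. *)
Lemma inv_coef_bound (a : nat -> C) (A : R) (n : nat) :
  a 0%nat <> 0 -> (forall k, (Cmod (a (S k)) <= A)%R) ->
  (Cmod (inv_coef a n) <= / Cmod (a 0%nat) * (1 + A / Cmod (a 0%nat)) ^ n)%R.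
Proof.
  intros Ha HA.
  assert (H0 : (0 < Cmod (a 0%nat))%R) by now apply Cmod_gt_0.
  assert (HA0 : (0 <= A)%R) by (eapply Rle_trans; [apply Cmod_ge_0 | apply (HA 0%nat)]).
  set (M := Cmod (a 0%nat)) in *; set (L := (1 + A / M)%R).
  assert (HL : (1 <= L)%R).
  { unfold L; assert (0 <= A / M)%R by (apply Rdiv_le_0_compat; lra); lra. }
  induction n as [n IH] using (well_founded_induction lt_wf).
  destruct n as [|n].
  - change (inv_coef a 0) with (/ a 0%nat); rewrite Cmod_inv by exact Ha.
    fold M; simpl; lra.
  - rewrite inv_coef_S, Cmod_mult, Cmod_opp, Cmod_inv by exact Ha.
    fold M; apply Rmult_le_compat_l; [left; now apply Rinv_0_lt_compat|].
    eapply Rle_trans.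
    { apply (Csum_norm_le _ (fun j => (L - 1) * L ^ (n - j))%R); intros k Hk.
      rewrite Cmod_mult.
      replace ((L - 1) * L ^ (n - k))%R with (A * (/ M * L ^ (n - k)))%R
        by (unfold L, Rdiv; ring).
      apply Rmult_le_compat; try apply Cmod_ge_0; [apply HA | apply IH; lia]. }
    rewrite (sum_n_mult_l (K := R_Ring)).
    change (mult ?x ?y) with (x * y)%R; rewrite geometric_sum_rev; lra.
Qed.

Lemma ex_series_geometric_bound (a : nat -> C) (K L : R) (t : C) :
  (forall n, (Cmod (a n) <= K * L ^ n)%R) -> (0 <= L)%R -> (L * Cmod t < 1)%R ->
  ex_series (fun n => Cmod (a n * t ^ n)).
Proof.
  intros H HL Ht.
  apply (ex_series_le (V := R_CompleteNormedModule)) with (fun n => K * (L * Cmod t) ^ n)%R.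
  - intros n; change (Rabs (Cmod (a n * t ^ n)) <= K * (L * Cmod t) ^ n)%R.
    rewrite Rabs_pos_eq by apply Cmod_ge_0.
    rewrite Cmod_mult, Cmod_pow, Rpow_mult_distr, <- Rmult_assoc.
    apply Rmult_le_compat_r; [apply pow_le, Cmod_ge_0 | apply H].
  - exists (K * / (1 - L * Cmod t))%R.
    apply (is_series_scal K (fun n => (L * Cmod t) ^ n)%R), is_series_geom.
    rewrite Rabs_pos_eq; [exact Ht|].
    apply Rmult_le_pos; [exact HL | apply Cmod_ge_0].
Qed.

Lemma Cseries_unique (a : nat -> C) (l l' : C) : Cseries a l -> Cseries a l' -> l = l'.
Proof.
  intros H H'; apply Cseries_components in H as [H1 H2].
  apply Cseries_components in H' as [H1' H2'].
  apply C_ext.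
  - now rewrite <- (is_series_unique _ _ H1), <- (is_series_unique _ _ H1').
  - now rewrite <- (is_series_unique _ _ H2), <- (is_series_unique _ _ H2').
Qed.

Lemma Cseries_eq (a : nat -> C) (l l' : C) : Cseries a l -> l = l' -> Cseries a l'.
Proof. now intros H <-. Qed.

Lemma Cseries_ex (a : nat -> C) :
  ex_series (fun n => Cmod (a n)) -> exists l : C, Cseries a l.
Proof.
  intros H.
  exact (ex_series_le (K := C_AbsRing) (V := C_CompleteNormedModule) a
           (fun n => Cmod (a n)) (fun n => Rle_refl _) H).
Qed.

Lemma Cseries_first (a : nat -> C) : (forall n, a (S n) = 0) -> Cseries a (a 0%nat).
Proof.
  intros H.
  assert (E : forall n, Csum a n = a 0%nat).
  { induction n as [|n IH]; [apply sum_O|]. rewrite Csum_Sn, IH, H; Cring. }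
  unfold is_series; eapply filterlim_ext; [intros n; symmetry; apply E|].
  apply filterlim_const.
Qed.

(** The Cauchy product of the two series is [1], which also shows that
    [alpha] does not vanish. *)
Lemma Cseries_inverse (a : nat -> C) (A : R) (t alpha : C) :
  a 0%nat <> 0 -> (forall k, (Cmod (a (S k)) <= A)%R) ->
  ((1 + A / Cmod (a 0%nat)) * Cmod t < 1)%R ->
  Cseries (fun n => a n * t ^ n) alpha ->
  alpha <> 0 /\ Cseries (fun n => inv_coef a n * t ^ n) (/ alpha).
Proof.
  intros Ha HA Ht Hs.
  assert (H0 : (0 < Cmod (a 0%nat))%R) by now apply Cmod_gt_0.
  assert (HA0 : (0 <= A)%R) by (eapply Rle_trans; [apply Cmod_ge_0 | apply (HA 0%nat)]).
  set (L := (1 + A / Cmod (a 0%nat))%R) in *.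
  assert (HL : (1 <= L)%R).
  { unfold L; assert (0 <= A / Cmod (a 0%nat))%R by (apply Rdiv_le_0_compat; lra); lra. }
  assert (Ht1 : (1 * Cmod t < 1)%R).
  { eapply Rle_lt_trans; [|exact Ht]; apply Rmult_le_compat_r; [apply Cmod_ge_0|exact HL]. }
  assert (Ea : ex_series (fun n => Cmod (a n * t ^ n))).
  { apply ex_series_geometric_bound with (Cmod (a 0%nat) + A)%R 1%R; [|lra|exact Ht1].
    intros n; rewrite pow1; destruct n as [|n]; [lra|]. specialize (HA n); lra. }
  assert (Ec : ex_series (fun n => Cmod (inv_coef a n * t ^ n))).
  { apply ex_series_geometric_bound with (/ Cmod (a 0%nat))%R L; [|lra|exact Ht].
    intros n; now apply inv_coef_bound. }
  destruct (Cseries_ex _ Ec) as [gamma Hg].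
  assert (Hp := Cseries_cauchy_product _ _ _ _ Hs Hg Ea Ec).
  assert (E1 : alpha * gamma = 1).
  { eapply Cseries_unique; [exact Hp|].
    eapply is_series_ext;
      [|apply (Cseries_first (fun n => if n then RtoC 1 else RtoC 0)); reflexivity].
    intros n; cbv beta.
    rewrite <- (inv_coef_convolution a n Ha) at 1.
    transitivity (t ^ n * Csum (fun k => a k * inv_coef a (n - k)%nat) n).
    - rewrite inv_coef_convolution by exact Ha; destruct n; simpl; Cring.
    - rewrite <- Csum_scal_l; apply sum_n_ext_loc; intros k Hk.
      replace n with (k + (n - k))%nat at 1 by lia.
      rewrite Cpow_add_r; Cring. }
  assert (Hne : alpha <> 0).
  { intros E; rewrite E, Cmult_0_l in E1; apply C1_nz; now symmetry. }
  split; [exact Hne|].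
  replace (/ alpha) with gamma; [exact Hg|].
  rewrite <- (Cmult_1_l (/ alpha)), <- E1; field; exact Hne.
Qed.

Lemma Cmod_fact_inv_le_1 (n : nat) : (Cmod (/ RtoC (INR (fact n))) <= 1)%R.
Proof.
  rewrite Cmod_inv by apply fact_C_neq_0.
  rewrite Cmod_R, Rabs_pos_eq by apply pos_INR.
  rewrite <- Rinv_1; apply Rinv_le_contravar; [lra|].
  apply (le_INR 1); pose proof (lt_O_fact n); lia.
Qed.

Lemma Cseries_shift (a : nat -> C) (l : C) :
  Cseries a l -> Cseries (fun n => a (S n)) (l - a 0%nat).
Proof.
  intros H; apply (is_series_incr_1 (V := C_NormedModule)).
  change (Cseries a (l - a 0%nat + a 0%nat)).
  replace (l - a 0%nat + a 0%nat) with l by ring; exact H.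
Qed.

Lemma Cseries_unshift (a : nat -> C) (l : C) :
  Cseries (fun n => a (S n)) l -> Cseries a (a 0%nat + l).
Proof.
  intros H; apply (is_series_decr_1 (V := C_NormedModule)).
  change (Cseries (fun n => a (S n)) (a 0%nat + l + - a 0%nat)).
  replace (a 0%nat + l + - a 0%nat) with l by ring; exact H.
Qed.

Lemma Cseries_scal (c : C) (a : nat -> C) (l : C) :
  Cseries a l -> Cseries (fun n => c * a n) (c * l).
Proof. exact (is_series_scal (V := C_NormedModule) c a l). Qed.

Lemma Cseries_exp_pow (t : C) : Cseries (fun n => / RtoC (INR (fact n)) * t ^ n) (Cexp t).
Proof.
  eapply is_series_ext; [|apply Cseries_exp]; intros n.
  unfold expterm; Ceq; field; apply fact_C_neq_0.
Qed.

(** * Coefficients of [t / (mu e^t - 1)] *)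

(** For [mu = 1] the denominator vanishes at [0] and one inverts
    [(e^t - 1) / t]; for [mu <> 1] one inverts [mu e^t - 1] itself and shifts the
    coefficients by one, so that the constant term is [0].  This is where
    [delta_(1, mu)] comes from.  The geometric bound is what later lets the
    series be multiplied by [e^(x t)]. *)
Lemma apostol_numbers (mu : C) :
  exists (b : nat -> C) (K L : R),
    b 0%nat = Cdelta (RtoC 1) mu /\ (0 < L)%R /\
    (forall n, (Cmod (b n) <= K * L ^ n)%R) /\
    forall t : C, t <> 0 -> (L * Cmod t < 1)%R ->
      mu * Cexp t - 1 <> 0 /\
      Cseries (fun n => b n * t ^ n) (t / (mu * Cexp t - 1)).
Proof.
  unfold Cdelta; destruct (Ceq_dec (RtoC 1) mu) as [<-|Hmu].
  - set (a := fun n => / RtoC (INR (fact (S n)))).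
    assert (Ha : a 0%nat = 1) by (unfold a; simpl; field).
    assert (Ha0 : a 0%nat <> 0) by (rewrite Ha; apply C1_nz).
    assert (HA : forall k, (Cmod (a (S k)) <= 1)%R) by (intros k; apply Cmod_fact_inv_le_1).
    assert (E0 : Cmod (a 0%nat) = 1%R) by (rewrite Ha; apply Cmod_1).
    exists (inv_coef a), 1%R, 2%R; split; [|split; [lra|split]].
    + change (inv_coef a 0) with (/ a 0%nat); rewrite Ha; field.
    + intros n; generalize (inv_coef_bound a 1 n Ha0 HA); rewrite E0.
      replace (1 + 1 / 1)%R with 2%R by field; now rewrite Rinv_1.
    + intros t Ht HL.
      assert (Hs : Cseries (fun n => a n * t ^ n) ((Cexp t - 1) / t)).
      { generalize (Cseries_scal (/ t) _ _ (Cseries_shift _ _ (Cseries_exp_pow t))).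
        simpl fact at 2; simpl INR at 2; simpl Cpow at 2; intros H.
        replace ((Cexp t - 1) / t) with (/ t * (Cexp t - / 1 * 1)) by (field; exact Ht).
        eapply is_series_ext; [|exact H]; intros n; cbv beta.
        rewrite Cpow_S; unfold a; Ceq; field; split; [apply fact_C_neq_0|exact Ht]. }
      apply (Cseries_inverse a 1) in Hs; try assumption.
      2:{ rewrite E0; replace (1 + 1 / 1)%R with 2%R by field; exact HL. }
      destruct Hs as [Hne Hs].
      assert (Hd : Cexp t - 1 <> 0).
      { intros E; apply Hne; rewrite E; field; exact Ht. }
      rewrite Cmult_1_l; split; [exact Hd|].
      replace (t / (Cexp t - 1)) with (/ ((Cexp t - 1) / t)); [exact Hs|].
      field; split; assumption.
  - set (a := fun n => match n with O => mu - 1 | S _ => mu * / RtoC (INR (fact n)) end).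
    assert (Ha0 : a 0%nat <> 0).
    { apply Cminus_eq_contra; congruence. }
    assert (HA : forall k, (Cmod (a (S k)) <= Cmod mu)%R).
    { intros k; change (a (S k)) with (mu * / RtoC (INR (fact (S k)))).
      rewrite Cmod_mult; rewrite <- (Rmult_1_r (Cmod mu)) at 2.
      apply Rmult_le_compat_l; [apply Cmod_ge_0 | apply Cmod_fact_inv_le_1]. }
    set (b := fun n => match n with O => RtoC 0 | S k => inv_coef a k end).
    set (L := (1 + Cmod mu / Cmod (a 0%nat))%R).
    assert (HM : (0 < Cmod (a 0%nat))%R) by now apply Cmod_gt_0.
    assert (HL : (1 <= L)%R).
    { unfold L; assert (0 <= Cmod mu / Cmod (a 0%nat))%R
        by (apply Rdiv_le_0_compat; [apply Cmod_ge_0|lra]); lra. }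
    assert (HK : (0 < / Cmod (a 0%nat))%R) by now apply Rinv_0_lt_compat.
    exists b, (/ Cmod (a 0%nat))%R, L; split; [reflexivity|split; [lra|split]].
    + intros [|n].
      * simpl b; rewrite Cmod_0; rewrite pow_O; lra.
      * eapply Rle_trans; [apply (inv_coef_bound a _ n Ha0 HA)|]; fold L.
        apply Rmult_le_compat_l; [lra|]; apply Rle_pow; [exact HL|lia].
    + intros t Ht Hlt.
      assert (Hs : Cseries (fun n => a n * t ^ n) (mu * Cexp t - 1)).
      { replace (mu * Cexp t - 1)
          with (a 0%nat * t ^ 0 + (mu * (Cexp t - / RtoC (INR (fact 0)) * t ^ 0)))
          by (simpl; field).
        apply (Cseries_unshift (fun n => a n * t ^ n)).
        eapply is_series_ext;
          [|exact (Cseries_scal mu _ _ (Cseries_shift _ _ (Cseries_exp_pow t)))].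
        intros n; change (a (S n)) with (mu * / RtoC (INR (fact (S n)))); apply Cmult_assoc. }
      apply (Cseries_inverse a (Cmod mu)) in Hs; try assumption.
      destruct Hs as [Hne Hs]; split; [exact Hne|].
      replace (t / (mu * Cexp t - 1)) with (b 0%nat * t ^ 0 + t * (/ (mu * Cexp t - 1)))
        by (simpl; field; exact Hne).
      apply (Cseries_unshift (fun n => b n * t ^ n)).
      eapply is_series_ext; [|exact (Cseries_scal t _ _ Hs)].
      intros n; cbv beta; rewrite Cpow_S; simpl b; Cring.
Qed.

(** * Complex-valued functions of a real variable *)

Notation Cderivative := (is_derive (K := R_AbsRing) (V := C_R_NormedModule)).
Notation Ccontinuous := (continuous (T := R_UniformSpace) (U := C_R_NormedModule)).

Lemma Cderivative_components (f : R -> C) (x : R) (l : C) :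
  Cderivative f x l <->
  is_derive (fun t => Re (f t)) x (Re l) /\ is_derive (fun t => Im (f t)) x (Im l).
Proof.
  split.
  - intros H; split.
    + exact (filterdiff_comp' f fst x _ _ H
        (filterdiff_linear (U := C_R_NormedModule) (V := R_NormedModule) fst
           (is_linear_fst (U := R_NormedModule) (V := R_NormedModule)))).
    + exact (filterdiff_comp' f snd x _ _ H
        (filterdiff_linear (U := C_R_NormedModule) (V := R_NormedModule) snd
           (is_linear_snd (U := R_NormedModule) (V := R_NormedModule)))).
  - intros [H1 H2].
    assert (E : forall z : C, plus (scal (Re z) (RtoC 1 : C_R_NormedModule))
                                  (scal (Im z) (Ci : C_R_NormedModule)) = z).
    { intros z; apply C_ext;
        do 3 (unfold plus, scal, mult; simpl); ring. }
    rewrite <- (E l).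
    apply is_derive_ext with
      (fun t => plus (scal (Re (f t)) (RtoC 1 : C_R_NormedModule))
                     (scal (Im (f t)) (Ci : C_R_NormedModule))).
    { intros t; apply E. }
    apply (is_derive_plus (V := C_R_NormedModule)).
    + apply (is_derive_scal_l (V := C_R_NormedModule) _ x _ _ H1).
    + apply (is_derive_scal_l (V := C_R_NormedModule) _ x _ _ H2).
Qed.

Lemma Ccontinuous_components (f : R -> C) (x : R) :
  Ccontinuous f x <->
  continuous (fun t => Re (f t)) x /\ continuous (fun t => Im (f t)) x.
Proof.
  split.
  - intros H; split.
    + apply (continuous_comp (V := C_R_NormedModule) f fst x H).
      apply (continuous_fst (U := R_UniformSpace) (V := R_UniformSpace) (fst (f x)) (snd (f x))).
    + apply (continuous_comp (V := C_R_NormedModule) f snd x H).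
      apply (continuous_snd (U := R_UniformSpace) (V := R_UniformSpace) (fst (f x)) (snd (f x))).
  - intros [H1 H2] P [eps HP].
    generalize (H1 _ (locally_ball (T := R_UniformSpace) (Re (f x)) eps))
      (H2 _ (locally_ball (T := R_UniformSpace) (Im (f x)) eps)).
    unfold filtermap; intros A B.
    generalize (filter_and _ _ A B); apply filter_imp.
    intros t [P1 P2]; apply HP; split; assumption.
Qed.

Lemma Cderivative_mult (f g : R -> C) (x : R) (df dg : C) :
  Cderivative f x df -> Cderivative g x dg ->
  Cderivative (fun t => f t * g t) x (df * g x + f x * dg).
Proof.
  intros Hf Hg.
  apply Cderivative_components in Hf as [Rf If].
  apply Cderivative_components in Hg as [Rg Ig].
  pose proof (is_derive_mult (K := R_AbsRing) _ _ x _ _ Rf Rg Rmult_comm) as A.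
  pose proof (is_derive_mult (K := R_AbsRing) _ _ x _ _ If Ig Rmult_comm) as B.
  pose proof (is_derive_mult (K := R_AbsRing) _ _ x _ _ Rf Ig Rmult_comm) as D.
  pose proof (is_derive_mult (K := R_AbsRing) _ _ x _ _ If Rg Rmult_comm) as E.
  apply Cderivative_components; split.
  - pose proof (is_derive_minus (V := R_NormedModule) _ _ x _ _ A B) as F.
    match type of F with is_derive _ _ ?l => replace (Re _) with l end; [exact F|].
    unfold minus, plus, opp, mult, Re, Im; simpl; ring.
  - pose proof (is_derive_plus (V := R_NormedModule) _ _ x _ _ D E) as F.
    match type of F with is_derive _ _ ?l => replace (Im _) with l end; [exact F|].
    unfold minus, plus, opp, mult, Re, Im; simpl; ring.
Qed.

Lemma Ccontinuous_mult (f g : R -> C) (x : R) :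
  Ccontinuous f x -> Ccontinuous g x -> Ccontinuous (fun t => f t * g t) x.
Proof.
  intros Hf Hg.
  apply Ccontinuous_components in Hf as [Rf If].
  apply Ccontinuous_components in Hg as [Rg Ig].
  apply Ccontinuous_components; split.
  - apply (continuous_minus (V := R_NormedModule) (fun t => Re (f t) * Re (g t))%R
      (fun t => Im (f t) * Im (g t))%R); apply (continuous_mult (K := R_AbsRing)); assumption.
  - apply (continuous_plus (V := R_NormedModule) (fun t => Re (f t) * Im (g t))%R
      (fun t => Im (f t) * Re (g t))%R); apply (continuous_mult (K := R_AbsRing)); assumption.
Qed.

Lemma Cderivative_const (c : C) (x : R) : Cderivative (fun _ => c) x (RtoC 0).
Proof. exact (is_derive_const (V := C_R_NormedModule) c x). Qed.

Lemma Cderivative_plus (f g : R -> C) (x : R) (df dg : C) :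
  Cderivative f x df -> Cderivative g x dg ->
  Cderivative (fun t => f t + g t) x (df + dg).
Proof. exact (is_derive_plus (V := C_R_NormedModule) f g x df dg). Qed.

Lemma Cderivative_scal (c : C) (f : R -> C) (x : R) (df : C) :
  Cderivative f x df -> Cderivative (fun t => c * f t) x (c * df).
Proof.
  intros H; replace (c * df) with (0 * f x + c * df) by ring.
  apply (Cderivative_mult (fun _ => c)); [apply Cderivative_const|exact H].
Qed.

Lemma Cderivative_Csum (f : nat -> R -> C) (n : nat) (x : R) (d : nat -> C) :
  (forall k, (k <= n)%nat -> Cderivative (f k) x (d k)) ->
  Cderivative (fun y => Csum (fun k => f k y) n) x (Csum d n).
Proof. exact (is_derive_sum_n (V := C_R_NormedModule) f n x d). Qed.

Lemma Cderivative_continuous (f : R -> C) (x : R) (l : C) :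
  Cderivative f x l -> Ccontinuous f x.
Proof.
  intros H; apply (ex_derive_continuous (V := C_R_NormedModule)); exists l; exact H.
Qed.

Lemma Cderivative_expterm (n : nat) (x : R) :
  Cderivative (fun t => expterm (S n) (RtoC t)) x (expterm n (RtoC x)).
Proof.
  assert (E : forall k t, expterm k (RtoC t) = RtoC (t ^ k / INR (fact k))).
  { intros k t; unfold expterm; now rewrite RtoC_div, RtoC_pow by apply INR_fact_neq_0. }
  rewrite E; apply is_derive_ext with (fun t => RtoC (t ^ S n / INR (fact (S n)))).
  { intros t; now rewrite E. }
  apply Cderivative_components; split; [|exact (is_derive_const (V := R_NormedModule) 0%R x)].
  change (is_derive (fun t => t ^ S n / INR (fact (S n)))%R x (x ^ n / INR (fact n))%R).
  assert (Hc : INR (fact (S n)) = (INR (S n) * INR (fact n))%R)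
    by now rewrite fact_simpl, mult_INR.
  revert Hc; generalize (INR (fact (S n))); intros c Hc.
  auto_derive; [trivial|].
  change (pred (S n)) with n; rewrite Hc.
  change (match n with 0%nat => 1%R | S _ => (INR n + 1)%R end) with (INR (S n)).
  field; split; [apply INR_fact_neq_0 | apply not_0_INR; lia].
Qed.

(** * Apostol-Bernoulli polynomials *)

Lemma pow_n_Cpow (t : C) (n : nat) : pow_n (K := C_Ring) t n = t ^ n.
Proof. induction n as [|n IH]; [reflexivity|]. simpl; now rewrite IH. Qed.

Lemma is_pseries_Cseries (a : nat -> C) (t l : C) :
  is_pseries (K := C_AbsRing) (V := C_NormedModule) a t l <->
  Cseries (fun n => a n * t ^ n) l.
Proof.
  assert (E : forall n, scal (pow_n (K := C_Ring) t n) (a n : C_NormedModule) = a n * t ^ n).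
  { intros n; rewrite pow_n_Cpow; apply Cmult_comm. }
  unfold is_pseries; split; apply is_series_ext; intros n; [apply E | symmetry; apply E].
Qed.

(** Here [d n x = sum_(k <= n) b_k x^(n-k) / (n-k)!], the coefficients of the
    Cauchy product of [t / (mu e^t - 1)] and [e^(x t)]; dividing by [n!] turns
    the Appell property into [d_(n+1)' = d_n].  By uniqueness of power series
    the description defining [apostol_bernoulli] pins down its value. *)
Lemma apostol_polynomials (mu : C) :
  exists d : nat -> R -> C,
    (forall n x, apostol_bernoulli n (RtoC x) mu = RtoC (INR (fact n)) * d n x) /\
    (forall x, d 0%nat x = Cdelta (RtoC 1) mu) /\
    (forall n x, Cderivative (d (S n)) x (d n x)) /\
    (forall n, mu * d n 1%R - d n 0%R = (if (n =? 1)%nat then RtoC 1 else RtoC 0)).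
Proof.
  destruct (apostol_numbers mu) as (b & K & L & Hb0 & HL & Hb & Hs).
  set (d := fun (n : nat) (x : R) => Csum (fun k => b k * expterm (n - k) (RtoC x)) n).
  assert (Hr : (0 < / L)%R) by now apply Rinv_0_lt_compat.
  assert (HrL : forall t, (Cmod t < / L)%R -> (L * Cmod t < 1)%R).
  { intros t Ht; apply (Rmult_lt_compat_l L) in Ht; [|exact HL].
    now rewrite Rinv_r in Ht by lra. }
  assert (Hgen : forall (x : R) (t : C), t <> 0 -> (Cmod t < / L)%R ->
    Cseries (fun n => d n x * t ^ n) (t * Cexp (x * t) / (mu * Cexp t - RtoC 1))).
  { intros x t Ht Hlt; apply HrL in Hlt.
    destruct (Hs t Ht Hlt) as [Hne Hst].
    replace (t * Cexp (x * t) / (mu * Cexp t - RtoC 1))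
      with (t / (mu * Cexp t - 1) * Cexp (x * t)) by (field; exact Hne).
    eapply is_series_ext;
      [|exact (Cseries_cauchy_product _ _ _ _ Hst (Cseries_exp (x * t))
          (ex_series_geometric_bound b K L t Hb (Rlt_le _ _ HL) Hlt)
          (ex_series_Cmod_expterm _))].
    intros n; cbv beta; rewrite (Cmult_comm (d n x)); unfold d; rewrite <- Csum_scal_l.
    apply sum_n_ext_loc; intros k Hk.
    replace (t ^ n) with (t ^ (k + (n - k))) by (f_equal; lia).
    rewrite Cpow_add_r; unfold expterm; rewrite Cpow_mult_l; Ceq.
    field; apply fact_C_neq_0. }
  exists d; split; [|split; [|split]].
  - intros n x; unfold apostol_bernoulli.
    assert (Huniq : forall B, is_apostol_bernoulli (RtoC x) mu B ->
        forall k, B k / RtoC (INR (fact k)) = d k x).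
    { intros B [r HB].
      apply C_power_series_unique with (Rmin r (/ L)).
      { apply Rmin_pos; [apply cond_pos | exact Hr]. }
      intros t Ht Hlt; exists (t * Cexp (x * t) / (mu * Cexp t - RtoC 1)); split.
      - apply is_pseries_Cseries, HB; [exact Ht|].
        eapply Rlt_le_trans; [exact Hlt | apply Rmin_l].
      - apply Hgen; [exact Ht|]; eapply Rlt_le_trans; [exact Hlt | apply Rmin_r]. }
    apply (iota_unique (V := C_R_CompleteNormedModule)).
    + intros c (B & HB & <-); rewrite <- (Huniq B HB).
      Ceq; field; apply fact_C_neq_0.
    + exists (fun k => RtoC (INR (fact k)) * d k x); split; [|reflexivity].
      exists (mkposreal _ Hr); intros t Ht Hlt.
      apply is_pseries_Cseries.
      eapply is_series_ext; [|exact (Hgen x t Ht Hlt)].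
      intros k; Ceq; field; apply fact_C_neq_0.
  - intros x; unfold d; rewrite sum_O, Nat.sub_diag, expterm_0, Hb0; apply Cmult_1_r.
  - intros n x.
    apply is_derive_ext with
      (fun t => Csum (fun k => b k * expterm (S (n - k)) (RtoC t)) n + b (S n)).
    { intros t; unfold d; rewrite Csum_Sn, Nat.sub_diag, expterm_0, Cmult_1_r; f_equal.
      apply sum_n_ext_loc; intros k Hk; now rewrite Nat.sub_succ_l. }
    replace (d n x) with (d n x + 0) by ring.
    apply Cderivative_plus; [|apply Cderivative_const].
    apply Cderivative_Csum; intros k _.
    apply Cderivative_scal, Cderivative_expterm.
  - apply C_power_series_unique with (/ L)%R; [exact Hr|].
    intros t Ht Hlt; exists t; split.
    + destruct (Hs t Ht (HrL t Hlt)) as [Hne _].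
      generalize (is_series_minus _ _ _ _
        (Cseries_scal mu _ _ (Hgen 1%R t Ht Hlt)) (Hgen 0%R t Ht Hlt)).
      replace (RtoC 1 * t) with t by ring.
      replace (Cexp (RtoC 0 * t)) with (RtoC 1).
      2:{ rewrite Cmult_0_l; unfold Cexp; apply C_ext; simpl;
          rewrite exp_0, cos_0, sin_0; ring. }
      intros H.
      assert (E : mu * (t * Cexp t / (mu * Cexp t - 1)) - t * 1 / (mu * Cexp t - 1) = t)
        by (field; exact Hne).
      refine (Cseries_eq _ _ _ _ E).
      eapply is_series_ext; [|exact H]; intros n.
      change (mu * (d n 1%R * t ^ n) - d n 0%R * t ^ n = (mu * d n 1%R - d n 0%R) * t ^ n).
      ring.
    + set (a := fun n => (if (n =? 1)%nat then RtoC 1 else RtoC 0) * t ^ n).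
      assert (E : a 0%nat + a 1%nat = t) by (unfold a; simpl; ring).
      refine (Cseries_eq _ _ _ _ E).
      apply Cseries_unshift, (Cseries_first (fun n => a (S n))).
      intros n; apply Cmult_0_l.
Qed.

(** * Integer powers *)

Lemma Cpowz_nat (z : C) (n : nat) : Cpowz z (Z.of_nat n) = z ^ n.
Proof.
  destruct n as [|n]; [reflexivity|]; simpl Z.of_nat; unfold Cpowz.
  now rewrite SuccNat2Pos.id_succ.
Qed.

Lemma Cpowz_opp_nat (z : C) (n : nat) : Cpowz z (- Z.of_nat n) = / z ^ n.
Proof.
  destruct n as [|n]; [simpl; field|]; simpl Z.of_nat; unfold Cpowz, Z.opp.
  now rewrite SuccNat2Pos.id_succ.
Qed.

(** Every integer is a difference of naturals, which reduces the laws of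
    integer exponents to those of natural ones without a case split on signs. *)
Lemma Cpowz_sub_nat (z : C) (m n : nat) :
  z <> 0 -> Cpowz z (Z.of_nat m - Z.of_nat n) = z ^ m / z ^ n.
Proof.
  intros Hz; destruct (Nat.le_ge_cases n m) as [H|H].
  - replace (Z.of_nat m - Z.of_nat n)%Z with (Z.of_nat (m - n)) by lia.
    replace (z ^ m) with (z ^ ((m - n) + n)) by (f_equal; lia).
    rewrite Cpowz_nat, Cpow_add_r; field; now apply Cpow_nz.
  - replace (Z.of_nat m - Z.of_nat n)%Z with (- Z.of_nat (n - m))%Z by lia.
    replace (z ^ n) with (z ^ ((n - m) + m)) by (f_equal; lia).
    rewrite Cpowz_opp_nat, Cpow_add_r; field; split; now apply Cpow_nz.
Qed.

Lemma Cpowz_add (z : C) (m n : Z) :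
  z <> 0 -> Cpowz z (m + n) = Cpowz z m * Cpowz z n.
Proof.
  intros Hz.
  assert (H : forall k, k = (Z.of_nat (Z.to_nat k) - Z.of_nat (Z.to_nat (- k)))%Z) by lia.
  rewrite (H m), (H n).
  generalize (Z.to_nat m) (Z.to_nat (- m)) (Z.to_nat n) (Z.to_nat (- n)); intros a b c e.
  replace (Z.of_nat a - Z.of_nat b + (Z.of_nat c - Z.of_nat e))%Z
    with (Z.of_nat (a + c) - Z.of_nat (b + e))%Z by lia.
  rewrite !Cpowz_sub_nat, !Cpow_add_r by exact Hz.
  field; split; now apply Cpow_nz.
Qed.

Lemma Cpowz_1_base (n : Z) : Cpowz 1 n = 1.
Proof.
  destruct n as [|p|p]; simpl; rewrite ?Cpow_1_l; try reflexivity; field.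
Qed.

Lemma Cpowz_mul (z : C) (q : nat) (s : Z) : z <> 0 -> Cpowz z (Z.of_nat q * s) = Cpowz (z ^ q) s.
Proof.
  intros Hz; destruct (Z.le_ge_cases 0 s) as [H|H].
  - replace s with (Z.of_nat (Z.to_nat s)) by lia.
    now rewrite <- Nat2Z.inj_mul, !Cpowz_nat, Cpow_mult_r.
  - replace s with (- Z.of_nat (Z.to_nat (- s)))%Z by lia.
    now rewrite Z.mul_opp_r, <- Nat2Z.inj_mul, !Cpowz_opp_nat, Cpow_mult_r.
Qed.

(** * The periodic weights on unit intervals *)

Notation Csum_from := (sum_n_m (G := C_AbelianMonoid)).

Lemma Csum_from_scal (c : C) (a : nat -> C) (m n : nat) :
  Csum_from (fun k => c * a k) m n = c * Csum_from a m n.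
Proof. exact (sum_n_m_mult_l (K := C_Ring) c a m n). Qed.

Lemma Csum_from_telescope (g : nat -> C) (n : nat) :
  Csum_from (fun r => g r - g (r - 1)%nat) 1 n = g n - g 0%nat.
Proof.
  induction n as [|n IH].
  - rewrite sum_n_m_zero by lia; change zero with (RtoC 0); Cring.
  - rewrite sum_n_Sm by lia; rewrite IH; simpl (S n - 1)%nat; rewrite Nat.sub_0_r.
    change (g n - g 0%nat + (g (S n) - g n) = g (S n) - g 0%nat); ring.
Qed.

Lemma Cderivative_Csum_from (f : nat -> R -> C) (m : nat) (x : R) (d : nat -> C) :
  (forall k, Cderivative (f k) x (d k)) ->
  Cderivative (fun y => Csum_from (fun k => f k y) 1 m) x (Csum_from d 1 m).
Proof.
  intros H; destruct m as [|m].
  - rewrite sum_n_m_zero by lia.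
    apply (is_derive_ext (V := C_R_NormedModule)) with (fun _ => RtoC 0); [|apply Cderivative_const].
    intros t; now rewrite sum_n_m_zero by lia.
  - rewrite <- sum_n_m_S.
    apply (is_derive_ext (V := C_R_NormedModule)) with (fun t => Csum (fun k => f (S k) t) m).
    { intros t; unfold sum_n; apply (sum_n_m_S (G := C_AbelianMonoid) (fun k => f k t)). }
    apply (Cderivative_Csum (fun k => f (S k)) m x (fun k => d (S k))).
    intros k _; apply H.
Qed.

(** [beta_(j, chi^-) ({x}_chi, lambda) / j!] on [n <= x < n + 1], continued as a
    polynomial in [x] beyond that interval: the floor is that of [(n + r) / q].
    The factor is written [q^j / q] so that [j = 0] is covered too. *)
Definition chi_weight (q : nat) (chi : Z -> C) (lambda : C) (d : nat -> R -> C)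
    (j : nat) (n : Z) (x : R) : C :=
  RtoC (INR q ^ j / INR q) *
  Csum_from (fun r =>
    let s := ((n + Z.of_nat r) / Z.of_nat q)%Z in
    chi (- Z.of_nat r)%Z * Cpowz lambda (Z.of_nat r - Z.of_nat q * s)
    * d j ((x + INR r) / INR q - IZR s)%R) 1 q.

Section Weight.
Variables (q : nat) (chi : Z -> C) (lambda : C) (d : nat -> R -> C).
Hypothesis hq : (0 < q)%nat.
Hypothesis hlambda : lambda <> 0.

Let hq' : (0 < INR q)%R := lt_0_INR q hq.

Lemma Int_part_residue (n : Z) (r : nat) (x : R) :
  (IZR n <= x < IZR n + 1)%R ->
  Int_part ((x + INR r) / INR q) = ((n + Z.of_nat r) / Z.of_nat q)%Z.
Proof.
  intros Hx; symmetry; apply Int_part_spec.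
  set (s := ((n + Z.of_nat r) / Z.of_nat q)%Z).
  assert (Hs1 : (Z.of_nat q * s <= n + Z.of_nat r)%Z) by (apply Z.mul_div_le; lia).
  assert (Hs2 : (n + Z.of_nat r + 1 <= Z.of_nat q * (s + 1))%Z).
  { generalize (Z.mul_succ_div_gt (n + Z.of_nat r) (Z.of_nat q)); fold s; lia. }
  apply IZR_le in Hs1, Hs2.
  rewrite mult_IZR, !plus_IZR in *; rewrite <- !INR_IZR_INZ in *.
  split.
  - apply (Rmult_lt_reg_r (INR q)); [exact hq'|].
    replace (((x + INR r) / INR q - 1) * INR q)%R with (x + INR r - INR q)%R
      by (field; lra).
    lra.
  - apply (Rmult_le_reg_r (INR q)); [exact hq'|].
    replace ((x + INR r) / INR q * INR q)%R with (x + INR r)%R by (field; lra).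
    lra.
Qed.

Lemma beta_chi_weight (j : nat) (n : Z) (x : R) :
  (1 <= j)%nat ->
  (forall y, apostol_bernoulli j (RtoC y) (lambda ^ q) = RtoC (INR (fact j)) * d j y) ->
  (IZR n <= x < IZR n + 1)%R ->
  beta_chi q chi j x lambda = RtoC (INR (fact j)) * chi_weight q chi lambda d j n x.
Proof.
  intros Hj Hd Hx; unfold beta_chi, chi_weight.
  replace (INR q ^ j / INR q)%R with (INR q ^ (j - 1))%R.
  2:{ replace j with (S (j - 1)) at 2 by lia; simpl; field; lra. }
  match goal with |- ?c * ?u = ?k * (?c * ?w) => cut (u = k * w); [intros ->; ring|] end.
  rewrite <- Csum_from_scal; apply sum_n_m_ext; intros r; cbv zeta.
  unfold frac_part; rewrite (Int_part_residue n r x Hx), Hd; Cring.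
Qed.

Lemma chi_weight_derivative (j : nat) (n : Z) (x : R) :
  (forall y, Cderivative (d (S j)) y (d j y)) ->
  Cderivative (chi_weight q chi lambda d (S j) n) x (chi_weight q chi lambda d j n x).
Proof.
  intros Hd; unfold chi_weight.
  replace (RtoC (INR q ^ j / INR q)) with (RtoC (INR q ^ S j / INR q) * RtoC (/ INR q)).
  2:{ rewrite <- RtoC_mult; f_equal; simpl; field; lra. }
  rewrite <- Cmult_assoc, <- Csum_from_scal.
  apply Cderivative_scal, Cderivative_Csum_from; intros r; cbv zeta.
  set (s := ((n + Z.of_nat r) / Z.of_nat q)%Z).
  set (y := ((x + INR r) / INR q - IZR s)%R).
  set (v := chi (- Z.of_nat r)%Z * Cpowz lambda (Z.of_nat r - Z.of_nat q * s)).
  replace (RtoC (/ INR q) * (v * d j y)) with (v * (RtoC (/ INR q) * d j y))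
    by ring.
  apply Cderivative_scal.
  (* The factor [1 / q] is the derivative of the inner affine function. *)
  rewrite <- scal_R_Cmult.
  apply (is_derive_comp (V := C_R_NormedModule) (d (S j)) (fun t => (t + INR r) / INR q - IZR s)%R).
  - apply Hd.
  - auto_derive; [trivial|]; field; lra.
Qed.

Lemma chi_weight_0 (n : Z) (x : R) :
  (forall y, d 0%nat y = Cdelta (RtoC 1) (lambda ^ q)) ->
  chi_weight q chi lambda d 0 n x = Cdelta (RtoC 1) (lambda ^ q) * beta0_chi q chi lambda.
Proof.
  intros Hd; unfold chi_weight, beta0_chi.
  replace (INR q ^ 0 / INR q)%R with (/ INR q)%R by (simpl; field; lra).
  match goal with |- ?c * ?u = ?k * (?c * ?w) => cut (u = k * w); [intros ->; ring|] end.
  rewrite <- Csum_from_scal; apply sum_n_m_ext; intros r; cbv zeta; rewrite Hd.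
  unfold Cdelta; destruct (Ceq_dec (RtoC 1) (lambda ^ q)) as [E|E]; [|Cring].
  set (s := ((n + Z.of_nat r) / Z.of_nat q)%Z).
  replace (Z.of_nat r - Z.of_nat q * s)%Z with (Z.of_nat r + Z.of_nat q * (- s))%Z by lia.
  rewrite Cpowz_add, Cpowz_mul, <- E, Cpowz_1_base, Cpowz_nat by exact hlambda; Cring.
Qed.

(** The [r]-th summand changes only if the floor of [(n + r) / q] differs from
    that of [(n - 1 + r) / q], in which case it increases by one.  Each summand
    therefore contributes the common value [chi (n) lambda ^ (- n)] times the
    increment of the floor, and the increments over [r = 1, ..., q] telescope to
    [1]. *)
Lemma chi_weight_jump (j : nat) (n : Z) :
  (1 <= j)%nat ->
  (forall k, chi (k + Z.of_nat q)%Z = chi k) ->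
  lambda ^ q * d j 1%R - d j 0%R = (if (j =? 1)%nat then RtoC 1 else RtoC 0) ->
  chi_weight q chi lambda d j (n - 1) (IZR n) - chi_weight q chi lambda d j n (IZR n)
  = if (j =? 1)%nat then chi n * Cpowz lambda (- n) else RtoC 0.
Proof.
  intros Hj Hchi Hd.
  assert (Hper : forall (s k : Z), chi (k + Z.of_nat q * s)%Z = chi k).
  { assert (Hn : forall (s : nat) (k : Z), chi (k + Z.of_nat q * Z.of_nat s)%Z = chi k).
    { induction s as [|s IH]; intros k; [f_equal; lia|].
      rewrite <- (IH k), <- (Hchi (k + Z.of_nat q * Z.of_nat s)%Z); f_equal; lia. }
    intros s k; destruct (Z.le_ge_cases 0 s) as [H|H].
    - rewrite <- (Hn (Z.to_nat s) k); f_equal; lia.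
    - rewrite <- (Hn (Z.to_nat (- s)) (k + Z.of_nat q * s)%Z); f_equal; lia. }
  set (e := fun r : nat => ((n + Z.of_nat r) / Z.of_nat q)%Z).
  set (delta := if (j =? 1)%nat then RtoC 1 else RtoC 0) in *.
  transitivity (RtoC (INR q ^ j / INR q) *
    Csum_from (fun r => delta * (chi n * Cpowz lambda (- n)) *
       (RtoC (IZR (e r)) - RtoC (IZR (e (r - 1)%nat)))) 1 q).
  - unfold chi_weight.
    match goal with |- ?c * ?u - _ * ?v = _ * ?w =>
      cut (u = v + w); [intros ->; ring|] end.
    etransitivity; [|apply (sum_n_m_plus (G := C_AbelianMonoid))].
    apply sum_n_m_ext_loc; intros r Hr; cbv zeta.
    (* The floor for [n - 1] and [r] is the one for [n] and [r - 1]; this is what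
       makes the sum telescope. *)
    replace (n - 1 + Z.of_nat r)%Z with (n + Z.of_nat (r - 1))%Z by lia.
    fold (e r) (e (r - 1)%nat).
    assert (H1 : (Z.of_nat q * e (r - 1)%nat <= n + Z.of_nat (r - 1))%Z)
      by (apply Z.mul_div_le; lia).
    assert (H2 : (n + Z.of_nat (r - 1) < Z.of_nat q * (e (r - 1)%nat + 1))%Z)
      by (generalize (Z.mul_succ_div_gt (n + Z.of_nat (r - 1)) (Z.of_nat q)); unfold e; lia).
    assert (H3 : (Z.of_nat q * e r <= n + Z.of_nat r)%Z) by (apply Z.mul_div_le; lia).
    assert (H4 : (n + Z.of_nat r < Z.of_nat q * (e r + 1))%Z)
      by (generalize (Z.mul_succ_div_gt (n + Z.of_nat r) (Z.of_nat q)); unfold e; lia).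
    destruct (Z.eq_dec (e r) (e (r - 1)%nat)) as [E|E].
    { rewrite <- E.
      match goal with |- ?a = plus ?b ?c => change (a = b + c) end; ring. }
    (* Consecutive numerators have floors differing by at most one, and a
       difference forces [q] to divide [n + r]. *)
    assert (E' : (e (r - 1)%nat = e r - 1)%Z) by nia.
    assert (En : (n = Z.of_nat q * e r - Z.of_nat r)%Z) by (rewrite E' in *; nia).
    assert (Ex : ((IZR n + INR r) / INR q = IZR (e r))%R).
    { rewrite En at 1; rewrite minus_IZR, mult_IZR, <- !INR_IZR_INZ; field; lra. }
    rewrite Ex, E', minus_IZR.
    replace (IZR (e r) - IZR (e r))%R with 0%R by ring.
    replace (IZR (e r) - (IZR (e r) - 1))%R with 1%R by ring.
    (* Here [n + r = q (e r)], so [d j] is evaluated at [1] from the left and at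
       [0] from the right, and the extra factor [lambda ^ q] on the left makes
       the difference [lambda ^ q * d j 1 - d j 0]. *)
    replace (Z.of_nat r - Z.of_nat q * (e r - 1))%Z with (- n + Z.of_nat q)%Z by lia.
    replace (Z.of_nat r - Z.of_nat q * e r)%Z with (- n)%Z by lia.
    replace (chi (- Z.of_nat r)%Z) with (chi n).
    2:{ rewrite <- (Hper (e r) (- Z.of_nat r)%Z); f_equal; lia. }
    rewrite Cpowz_add, Cpowz_nat, <- Hd, RtoC_minus by exact hlambda.
    match goal with |- ?a = plus ?b ?c => change (a = b + c) end; ring.
  - rewrite Csum_from_scal, (Csum_from_telescope (fun r => RtoC (IZR (e r)))).
    replace (e q) with (e 0%nat + 1)%Z.
    2:{ unfold e; rewrite <- (Z.div_add _ 1) by lia; f_equal; lia. }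
    rewrite plus_IZR, RtoC_plus; unfold delta.
    destruct (Nat.eqb_spec j 1) as [->|Hne]; [|ring].
    replace (INR q ^ 1 / INR q)%R with 1%R by (simpl; field; lra); ring.
Qed.
End Weight.

(** * Extending one-sided calculus to the line *)

Definition clamp (a b x : R) : R := Rmax a (Rmin b x).

Lemma clamp_bounds (a b x : R) : (a <= b)%R -> (a <= clamp a b x <= b)%R.
Proof.
  intros H; unfold clamp; split; [apply Rmax_l|].
  apply Rmax_lub; [exact H|apply Rmin_l].
Qed.

Lemma clamp_id (a b x : R) : (a <= x <= b)%R -> clamp a b x = x.
Proof.
  intros H; unfold clamp; rewrite Rmin_right, Rmax_right; lra.
Qed.

Lemma clamp_lipschitz (a b x y : R) : (Rabs (clamp a b y - clamp a b x) <= Rabs (y - x))%R.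
Proof.
  unfold clamp, Rmax, Rmin, Rabs; repeat destruct Rle_dec; repeat destruct Rcase_abs; lra.
Qed.

Notation within_interval a b x :=
  (within (fun y => a <= y <= b)%R (locally (T := R_UniformSpace) x)).

Lemma within_interval_proper (a b x : R) :
  (a <= x <= b)%R -> ProperFilter (within_interval a b x).
Proof.
  intros Hx; constructor; [|apply within_filter, locally_filter].
  intros P HP; exists x; exact (locally_singleton x _ HP Hx).
Qed.

Lemma within_interval_lim (a b x : R) : is_filter_lim (within_interval a b x) x.
Proof. intros P HP; unfold within; generalize HP; apply filter_imp; auto. Qed.

Lemma filterlim_clamp (a b x : R) :
  (a <= b)%R -> filterlim (clamp a b) (locally x) (within_interval a b (clamp a b x)).
Proof.
  intros Hab P [eps HP]; exists eps; intros y Hy.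
  apply HP; [|now apply clamp_bounds].
  eapply Rle_lt_trans; [apply clamp_lipschitz | exact Hy].
Qed.

Lemma is_derive_on_minus (a b : R) (f g : R -> C) (x : R) (l l' : C) :
  is_derive_on a b f x l -> is_derive_on a b g x l' ->
  is_derive_on a b (fun t => f t - g t) x (l - l').
Proof.
  intros Hf Hg.
  eapply (filterdiff_ext_lin (V := C_R_NormedModule));
    [exact (filterdiff_minus_fct (V := C_R_NormedModule) _ _ _ _ Hf Hg)|].
  intros y; symmetry; apply (scal_minus_distr_l (V := C_R_NormedModule) y l l').
Qed.

Lemma Cderivative_is_derive_on (a b : R) (f : R -> C) (x : R) (l : C) :
  (a <= x <= b)%R -> Cderivative f x l -> is_derive_on a b f x l.
Proof.
  intros Hx Hf.
  exact (@filterdiff_locally _ _ _ _ (within_interval_proper a b x Hx) _ _ _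
           (within_interval_lim a b x) Hf).
Qed.

(** Precomposing with the nearest-point projection onto [[a, b]], which is
    1-Lipschitz, turns a vanishing one-sided derivative into a two-sided one. *)
Lemma is_derive_on_clamp (a b : R) (f : R -> C) (x : R) :
  (a <= x <= b)%R -> is_derive_on a b f x (RtoC 0) ->
  Cderivative (fun t => f (clamp a b t)) x (RtoC 0).
Proof.
  intros Hx [Hl Hd]; split; [exact Hl|]; intros y Hy.
  apply (is_filter_lim_locally_unique (V := AbsRing_NormedModule R_AbsRing)) in Hy; subst y.
  intros eps.
  specialize (Hd x (within_interval_lim a b x) eps).
  assert (Hab : (a <= b)%R) by lra.
  generalize (filterlim_clamp a b x Hab); rewrite (clamp_id a b x Hx); intros Hc.
  generalize (Hc _ Hd); unfold filtermap; apply filter_imp; intros y Hy.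
  assert (Z : forall u : R, scal u (RtoC 0 : C_R_NormedModule) = RtoC 0).
  { intros u; apply (scal_zero_r (V := C_R_NormedModule)). }
  rewrite Z in Hy |- *.
  eapply Rle_trans; [exact Hy|].
  apply Rmult_le_compat_l; [apply Rlt_le, cond_pos|].
  rewrite <- (clamp_id a b x Hx) at 1; apply clamp_lipschitz.
Qed.

Lemma is_derive_on_0_const (a b : R) (f : R -> C) (x : R) :
  (forall y, (a <= y <= b)%R -> is_derive_on a b f y (RtoC 0)) ->
  (a <= x <= b)%R -> f x = f a.
Proof.
  intros Hf Hx; destruct (Req_dec a x) as [->|Hne]; [reflexivity|].
  generalize (eq_is_derive (V := C_R_NormedModule) (fun t => f (clamp a b t)) a x).
  rewrite !clamp_id by lra; intros H; symmetry; apply H; [|lra].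
  intros t Ht; apply is_derive_on_clamp; [lra|apply Hf; lra].
Qed.

(** Near every [x] in [[a, b]] there are other points of [[a, b]], because the
    interval is nondegenerate; at one close enough a nonzero difference of
    two derivatives contradicts the error bound for [eps = |l - l'| / 2]. *)
Lemma is_derive_on_unique (a b : R) (f : R -> C) (x : R) (l l' : C) :
  (a < b)%R -> (a <= x <= b)%R ->
  is_derive_on a b f x l -> is_derive_on a b f x l' -> l = l'.
Proof.
  intros Hab Hx H H'.
  destruct (is_derive_on_minus _ _ _ _ _ _ _ H H') as [_ Hd].
  specialize (Hd x (within_interval_lim a b x)).
  set (k := l - l').
  destruct (Ceq_dec k 0) as [E|E]; [now apply Ceq_minus|exfalso].
  assert (Hk : (0 < norm (k : C_R_NormedModule))%R).
  { apply norm_gt_0; exact E. }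
  assert (Hk2 : (0 < norm (k : C_R_NormedModule) / 2)%R) by lra.
  destruct (Hd (mkposreal _ Hk2)) as [delta Hdelta]; simpl pos in Hdelta.
  assert (Hy : exists y, (a <= y <= b /\ y <> x /\ Rabs (y - x) < delta)%R).
  { pose proof (cond_pos delta) as Hpos.
    destruct (Rlt_dec x b) as [Hb|Hb].
    - exists (x + Rmin (b - x) (delta / 2))%R.
      assert (0 < Rmin (b - x) (delta / 2))%R by (apply Rmin_pos; lra).
      pose proof (Rmin_l (b - x) (delta / 2)); pose proof (Rmin_r (b - x) (delta / 2)).
      repeat split; try lra. rewrite Rabs_pos_eq; lra.
    - exists (x - Rmin (x - a) (delta / 2))%R.
      assert (0 < Rmin (x - a) (delta / 2))%R by (apply Rmin_pos; lra).
      pose proof (Rmin_l (x - a) (delta / 2)); pose proof (Rmin_r (x - a) (delta / 2)).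
      repeat split; try lra. rewrite Rabs_left; lra. }
  destruct Hy as (y & Hy1 & Hy2 & Hy3).
  specialize (Hdelta y Hy3 Hy1).
  match type of Hdelta with (norm ?z <= _)%R =>
    replace (norm z) with (norm (opp (scal (V := C_R_NormedModule) (y - x)%R k))) in Hdelta end.
  2:{ f_equal.
      match goal with |- opp ?s1 = minus ?p ?s2 => change s2 with s1; generalize s1 end.
      intros s; change (- s = f y - f y - (f x - f x) - s); ring. }

  rewrite (norm_opp (V := C_R_NormedModule)) in Hdelta.
  change (norm (minus y x)) with (Rabs (y - x)) in Hdelta.
  assert (Hu : (0 < Rabs (y - x))%R) by (apply Rabs_pos_lt; lra).
  assert (Hge : (Rabs (y - x) * norm (k : C_R_NormedModule)
                 <= norm (scal (V := C_R_NormedModule) (y - x)%R k))%R).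
  { pose proof (norm_scal (V := C_R_NormedModule) (/ (y - x))%R (scal (y - x)%R k)) as Hn.
    rewrite scal_assoc in Hn.
    change (mult (/ (y - x))%R (y - x)%R) with (/ (y - x) * (y - x))%R in Hn.
    rewrite Rinv_l, (scal_one (V := C_R_NormedModule)) in Hn by lra.
    change (abs (/ (y - x))%R) with (Rabs (/ (y - x))) in Hn.
    rewrite Rabs_inv in Hn.
    apply (Rmult_le_compat_l (Rabs (y - x))) in Hn; [|lra].
    rewrite <- Rmult_assoc, Rinv_r, Rmult_1_l in Hn by lra; exact Hn. }
  nra.
Qed.

(** The primitive of [g] through [f a] differs from [f] on [[a, b]] by a function
    with zero derivative. *)
Lemma primitive_extension (a b : R) (f g : R -> C) :
  (a < b)%R -> (forall x, Ccontinuous g x) ->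
  (forall x, (a <= x <= b)%R -> is_derive_on a b f x (g x)) ->
  exists F : R -> C, (forall x, Cderivative F x (g x)) /\
    forall x, (a <= x <= b)%R -> F x = f x.
Proof.
  intros Hab Hg Hf.
  set (F := fun x => f a + C_RInt g a x).
  assert (HF : forall x, Cderivative F x (g x)).
  { intros x; replace (g x) with (RtoC 0 + g x) by ring.
    apply Cderivative_plus; [apply Cderivative_const|].
    apply (is_derive_RInt (V := C_R_NormedModule) g (C_RInt g a) a x); [|apply Hg].
    apply filter_forall; intros y.
    apply (RInt_correct (V := C_R_CompleteNormedModule)).
    apply (ex_RInt_continuous (V := C_R_CompleteNormedModule)); intros z _; apply Hg. }
  exists F; split; [exact HF|]; intros x Hx.
  assert (Hd : forall y, (a <= y <= b)%R -> is_derive_on a b (fun t => F t - f t) y (RtoC 0)).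
  { intros y Hy; replace (RtoC 0) with (g y - g y) by ring.
    apply is_derive_on_minus; [|now apply Hf].
    apply Cderivative_is_derive_on; [exact Hy|apply HF]. }
  generalize (is_derive_on_0_const a b _ x Hd Hx); unfold F at 2.
  unfold C_RInt; rewrite (RInt_point (V := C_R_CompleteNormedModule)).
  change (zero : C_R_CompleteNormedModule) with (RtoC 0); intros E.
  replace (F x) with (F x - f x + f x) by ring; rewrite E; ring.
Qed.

(** Descending from the top: the highest derivative is extended by constants,
    and each lower one by integrating the extension of the next. *)
Lemma Cn_extension (a b : R) (N : nat) (F : nat -> R -> C) :
  (a < b)%R ->
  (forall k x, (k < N)%nat -> (a <= x <= b)%R -> is_derive_on a b (F k) x (F (S k) x)) ->
  continuous_on (U := C_R_NormedModule) (fun x => a <= x <= b)%R (F N) ->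
  exists G : nat -> R -> C,
    (forall k x, (k <= N)%nat -> (a <= x <= b)%R -> G k x = F k x) /\
    (forall k x, (k < N)%nat -> Cderivative (G k) x (G (S k) x)) /\
    (forall x, Ccontinuous (G N) x).
Proof.
  intros Hab; revert F; induction N as [|N IH]; intros F HF HN.
  - exists (fun k x => F k (clamp a b x)); split; [|split].
    + intros k x _ Hx; now rewrite clamp_id.
    + intros; lia.
    + intros x; eapply filterlim_comp; [apply filterlim_clamp; lra|].
      apply HN, clamp_bounds; lra.
  - destruct (IH (fun k => F (S k))) as (G & HG1 & HG2 & HG3).
    { intros k x Hk Hx; apply HF; [lia|exact Hx]. }
    { exact HN. }
    assert (Hc : forall x, Ccontinuous (G 0%nat) x).
    { intros x; destruct N as [|N]; [apply HG3|].
      apply Cderivative_continuous with (G 1%nat x), HG2; lia. }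
    destruct (primitive_extension a b (F 0%nat) (G 0%nat) Hab Hc) as (G0 & HG0 & HG0').
    { intros x Hx; rewrite HG1 by (lia || exact Hx); apply HF; [lia|exact Hx]. }
    exists (fun k => match k with O => G0 | S k => G k end); split; [|split].
    + intros [|k] x Hk Hx; [now apply HG0'|apply HG1; [lia|exact Hx]].
    + intros [|k] x Hk; [apply HG0|apply HG2; lia].
    + exact HG3.
Qed.

Lemma is_Cn_on_extension (a b : R) (N : nat) (f : R -> C) :
  (a < b)%R -> is_Cn_on a b N f ->
  exists G : nat -> R -> C,
    (forall k x, (k <= N)%nat -> (a <= x <= b)%R -> G k x = Derive_n_on a b f k x) /\
    (forall k x, (k < N)%nat -> Cderivative (G k) x (G (S k) x)) /\
    (forall x, Ccontinuous (G N) x).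
Proof.
  intros Hab [Hd Hc]; apply Cn_extension; [exact Hab| |exact Hc].
  intros k x Hk Hx; destruct (Hd k x Hk Hx) as [l Hl].
  simpl; unfold Derive_on.
  apply (iota_correct (V := C_R_CompleteNormedModule) (is_derive_on a b (Derive_n_on a b f k) x)).
  exists l; split; [exact Hl|]; intros l' Hl'.
  eapply is_derive_on_unique; eassumption.
Qed.

(** * Euler-Maclaurin summation with piecewise weights *)

Notation is_CRInt := (is_RInt (V := C_R_NormedModule)).

Lemma is_CRInt_scal (c : C) (f : R -> C) (a b : R) (l : C) :
  is_CRInt f a b l -> is_CRInt (fun t => c * f t) a b (c * l).
Proof.
  intros H.
  pose proof (is_RInt_fct_extend_fst (U := R_NormedModule) (V := R_NormedModule) f a b l H) as H1.
  pose proof (is_RInt_fct_extend_snd (U := R_NormedModule) (V := R_NormedModule) f a b l H) as H2.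
  apply (is_RInt_fct_extend_pair (U := R_NormedModule) (V := R_NormedModule)).
  - exact (is_RInt_minus (V := R_NormedModule) _ _ _ _ _ _
      (is_RInt_scal (V := R_NormedModule) _ _ _ (fst c) _ H1)
      (is_RInt_scal (V := R_NormedModule) _ _ _ (snd c) _ H2)).
  - exact (is_RInt_plus (V := R_NormedModule) _ _ _ _ _ _
      (is_RInt_scal (V := R_NormedModule) _ _ _ (fst c) _ H2)
      (is_RInt_scal (V := R_NormedModule) _ _ _ (snd c) _ H1)).
Qed.

Lemma Csum_telescope (T : nat -> C) (n : nat) :
  Csum (fun k => T k - T (S k)) n = T 0%nat - T (S n).
Proof.
  induction n as [|n IH]; [apply sum_O|].
  rewrite Csum_Sn, IH; Cring.
Qed.

Lemma sum_Z_oc_empty (a b : R) (F : Z -> C) :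
  Int_part b = Int_part a -> sum_Z_oc a b F = 0.
Proof.
  intros E; unfold sum_Z_oc, Zrange_oc; now rewrite E, Z.sub_diag.
Qed.

Lemma Int_part_IZR_eq (n : Z) : Int_part (IZR n) = n.
Proof. symmetry; apply Int_part_spec; lra. Qed.

Lemma sum_Z_oc_cons (a b : R) (F : Z -> C) :
  (Int_part a < Int_part b)%Z ->
  sum_Z_oc a b F = F (Int_part a + 1)%Z + sum_Z_oc (IZR (Int_part a + 1)) b F.
Proof.
  intros H; unfold sum_Z_oc, Zrange_oc; rewrite Int_part_IZR_eq.
  replace (Z.to_nat (Int_part b - Int_part a))
    with (S (Z.to_nat (Int_part b - (Int_part a + 1)))) by lia.
  rewrite <- List.cons_seq, <- List.seq_shift.
  cbn [List.map List.fold_right]; f_equal.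
  rewrite !List.map_map; f_equal; apply List.map_ext; intros i; f_equal; lia.
Qed.

Section EulerMaclaurin.
Variables (m : nat) (w : nat -> Z -> R -> C) (c : C) (X : Z -> C) (G : nat -> R -> C).
Hypothesis w_0 : forall n x, w 0%nat n x = c.
Hypothesis w_derivative : forall j n x, Cderivative (w (S j) n) x (w j n x).
Hypothesis w_jump : forall j n,
  w (S j) (n - 1)%Z (IZR n) - w (S j) n (IZR n) = if (j =? 0)%nat then X n else 0.
Hypothesis G_derivative : forall k x, (k <= m)%nat -> Cderivative (G k) x (G (S k) x).
Hypothesis G_continuous : forall x, Ccontinuous (G (S m)) x.

(** Chosen so that the derivative telescopes, with
    [T k = (-1)^k * w k n * G k] as the telescoping terms. *)
Let Psi (n : Z) (x : R) : C :=
  Csum (fun k => RtoC ((-1) ^ k) * (w (S k) n x * G k x)) m.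

Let integrand (n : Z) (x : R) : C :=
  c * G 0%nat x + RtoC ((-1) ^ m) * (w (S m) n x * G (S m) x).

Lemma Psi_derivative (n : Z) (x : R) : Cderivative (Psi n) x (integrand n x).
Proof.
  set (T := fun k => RtoC ((-1) ^ k) * (w k n x * G k x)).
  replace (integrand n x) with (Csum (fun k => T k - T (S k)) m).
  2:{ rewrite Csum_telescope; unfold T, integrand; rewrite w_0; simpl pow.
      rewrite RtoC_mult; change (-1)%R with (- (1))%R; rewrite RtoC_opp; Cring. }
  apply (Cderivative_Csum (fun k x => RtoC ((-1) ^ k) * (w (S k) n x * G k x))).
  intros k Hk.
  replace (T k - T (S k)) with
    (RtoC ((-1) ^ k) * (w k n x * G k x + w (S k) n x * G (S k) x)).
  2:{ unfold T; simpl pow; rewrite RtoC_mult; change (-1)%R with (- (1))%R at 3.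
      rewrite RtoC_opp; Cring. }
  apply Cderivative_scal, Cderivative_mult; [apply w_derivative|now apply G_derivative].
Qed.

Lemma integrand_continuous (n : Z) (x : R) : Ccontinuous (integrand n) x.
Proof.
  apply (continuous_plus (V := C_R_NormedModule) (fun t => c * G 0%nat t)).
  - apply Ccontinuous_mult; [apply continuous_const|].
    eapply Cderivative_continuous, G_derivative; lia.
  - apply Ccontinuous_mult; [apply continuous_const|].
    apply Ccontinuous_mult; [|apply G_continuous].
    eapply Cderivative_continuous, w_derivative.
Qed.

Lemma Psi_jump (n : Z) : Psi (n - 1) (IZR n) - Psi n (IZR n) = X n * G 0%nat (IZR n).
Proof.
  assert (H : forall M,
     Csum (fun k => RtoC ((-1) ^ k) * (w (S k) (n - 1)%Z (IZR n) * G k (IZR n))) M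
     - Csum (fun k => RtoC ((-1) ^ k) * (w (S k) n (IZR n) * G k (IZR n))) M
     = X n * G 0%nat (IZR n)).
  { induction M as [|M IH].
    - rewrite !sum_O; generalize (w_jump 0 n); simpl (0 =? 0)%nat; cbv iota; intros <-.
      simpl pow; Cring.
    - rewrite !Csum_Sn.
      generalize (w_jump (S M) n); simpl (S M =? 0)%nat; cbv iota; intros E.
      apply Ceq_minus in E.
      transitivity (X n * G 0%nat (IZR n)
        + RtoC ((-1) ^ S M)
          * ((w (S (S M)) (n - 1)%Z (IZR n) - w (S (S M)) n (IZR n)) * G (S M) (IZR n)));
        [rewrite <- IH; Cring|].
      rewrite E; Cring. }
  apply H.
Qed.

Lemma integrand_piece (n : Z) (a b : R) (f : R -> C) :
  (a <= b)%R -> (forall x, (a < x < b)%R -> f x = integrand n x) ->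
  is_CRInt f a b (Psi n b - Psi n a).
Proof.
  intros Hab Hf.
  apply is_RInt_ext with (integrand n).
  { rewrite Rmin_left, Rmax_right by exact Hab; intros x Hx; symmetry; now apply Hf. }
  apply (is_RInt_derive (V := C_R_CompleteNormedModule) (Psi n) (integrand n)).
  - intros x _; apply Psi_derivative.
  - intros x _; apply integrand_continuous.
Qed.

(** Induction on the number of integers in [(a, b]], splitting off the part up
    to the first of them, where the jump of [Psi] produces one summand. *)
Lemma euler_maclaurin (a b : R) :
  (a <= b)%R ->
  is_CRInt (fun t => integrand (Int_part t) t) a b
    (Psi (Int_part b) b - Psi (Int_part a) a
     + sum_Z_oc a b (fun k => X k * G 0%nat (IZR k))).
Proof.
  intros Hab.
  assert (Hle : (Int_part a <= Int_part b)%Z).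
  { apply Z.lt_succ_r, lt_IZR; rewrite succ_IZR.
    destruct (base_Int_part a), (base_Int_part b); lra. }
  remember (Z.to_nat (Int_part b - Int_part a)) as N eqn:HN.
  revert a Hab Hle HN; induction N as [|N IH]; intros a Hab Hle HN.
  - assert (E : Int_part b = Int_part a) by lia.
    rewrite sum_Z_oc_empty, E, Cplus_0_r by exact E.
    apply integrand_piece; [exact Hab|].
    intros x Hx; f_equal; symmetry; apply Int_part_spec.
    destruct (base_Int_part a), (base_Int_part b); rewrite E in *; lra.
  - set (n := (Int_part a + 1)%Z).
    destruct (base_Int_part a) as [Ha1 Ha2].
    assert (Hn : IZR n = (IZR (Int_part a) + 1)%R) by (unfold n; apply plus_IZR).
    assert (Hnb : (IZR n <= b)%R).
    { apply Rle_trans with (IZR (Int_part b)); [apply IZR_le; lia|apply base_Int_part]. }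
    rewrite sum_Z_oc_cons by lia; fold n.
    replace (Psi (Int_part b) b - Psi (Int_part a) a +
        (X n * G 0%nat (IZR n) + sum_Z_oc (IZR n) b (fun k => X k * G 0%nat (IZR k))))
      with ((Psi (Int_part a) (IZR n) - Psi (Int_part a) a)
         + (Psi (Int_part b) b - Psi (Int_part (IZR n)) (IZR n)
            + sum_Z_oc (IZR n) b (fun k => X k * G 0%nat (IZR k)))).
    2:{ rewrite <- Psi_jump, Int_part_IZR_eq.
        replace (n - 1)%Z with (Int_part a) by lia; Cring. }
    apply (is_RInt_Chasles (V := C_R_NormedModule)) with (IZR n).
    + apply integrand_piece; [lra|].
      intros x Hx; f_equal; symmetry; apply Int_part_spec; lra.
    + apply IH; rewrite ?Int_part_IZR_eq; [exact Hnb|lia|lia].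
Qed.
End EulerMaclaurin.

(** * The summation formula *)

Lemma sum_Z_oc_ext (a b : R) (F H : Z -> C) :
  (forall k, (a < IZR k <= b)%R -> F k = H k) -> sum_Z_oc a b F = sum_Z_oc a b H.
Proof.
  intros E; unfold sum_Z_oc; f_equal; apply List.map_ext_in; intros k Hk.
  apply E; now apply Zrange_oc_In.
Qed.

Theorem theorem2p1 (q m : nat) (a b : R) (chi : Z -> C) (f : R -> C) (lambda : C)
  (hq : (0 < q)%nat)
  (hab : (a < b)%R)
  (hchi : is_dirichlet_character q chi)
  (hf : is_Cn_on a b (m + 1) f)
  (hlambda : lambda <> RtoC 0) :
  sum_Z_oc a b (fun k => chi k * Cpowz lambda (- k) * f (IZR k))
  = sum_n (G := C_AbelianMonoid)
      (fun k =>
         RtoC ((-1) ^ (k + 1) / INR (fact (k + 1))) *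
         (beta_chi q chi (k + 1) b lambda * Derive_n_on a b f k b
          - beta_chi q chi (k + 1) a lambda * Derive_n_on a b f k a)) m
    + Cdelta (RtoC 1) (lambda ^ q) * beta0_chi q chi lambda * C_RInt f a b
    + RtoC ((-1) ^ m / INR (fact (m + 1))) *
      C_RInt (fun t => beta_chi q chi (m + 1) t lambda * Derive_n_on a b f (m + 1) t) a b.
Proof.
  destruct hchi as [_ [hper _]].
  rewrite Nat.add_1_r in hf |- *.
  destruct (is_Cn_on_extension a b (S m) f hab hf) as (G & HGf & HG & HGc).
  destruct (apostol_polynomials (lambda ^ q)) as (d & Hd & Hd0 & Hd' & Hdj).
  set (w := chi_weight q chi lambda d).
  set (c := Cdelta (RtoC 1) (lambda ^ q) * beta0_chi q chi lambda).
  set (X := fun n => chi n * Cpowz lambda (- n)).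
  assert (Hbeta : forall j x, beta_chi q chi (S j) x lambda
            = RtoC (INR (fact (S j))) * w (S j) (Int_part x) x).
  { intros j x; apply beta_chi_weight; [exact hq|lia|apply Hd|].
    destruct (base_Int_part x); lra. }
  assert (HI := euler_maclaurin m w c X G
    (fun n x => chi_weight_0 q chi lambda d hq hlambda n x Hd0)
    (fun j n x => chi_weight_derivative q chi lambda d hq j n x (Hd' j))
    (fun j n => chi_weight_jump q chi lambda d hq hlambda (S j) n
       (le_n_S _ _ (Nat.le_0_l j)) hper (Hdj (S j)))
    (fun k x Hk => HG k x (le_n_S _ _ Hk)) HGc a b (Rlt_le _ _ hab)).
  cbv beta zeta in HI.
  set (Psi := fun n x => Csum (fun k => RtoC ((-1) ^ k) * (w (S k) n x * G k x)) m).
  set (S0 := sum_Z_oc a b (fun k => X k * G 0%nat (IZR k))) in HI.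
  change (is_CRInt
    (fun t => c * G 0%nat t + RtoC ((-1) ^ m) * (w (S m) (Int_part t) t * G (S m) t)) a b
    (Psi (Int_part b) b - Psi (Int_part a) a + S0)) in HI.
  set (I0 := C_RInt f a b).
  assert (HI0 : is_CRInt (G 0%nat) a b I0).
  { apply is_RInt_ext with f.
    { rewrite Rmin_left, Rmax_right by lra; intros x Hx; symmetry.
      apply HGf; [lia|lra]. }
    apply (RInt_correct (V := C_R_CompleteNormedModule)).
    apply (ex_RInt_ext (V := C_R_CompleteNormedModule) (G 0%nat)).
    { rewrite Rmin_left, Rmax_right by lra; intros x Hx; apply HGf; [lia|lra]. }
    apply (ex_RInt_continuous (V := C_R_CompleteNormedModule)); intros x _.
    apply Cderivative_continuous with (G 1%nat x), HG; lia. }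
  assert (Hsgn : RtoC ((-1) ^ m) * RtoC ((-1) ^ m) = 1).
  { rewrite <- RtoC_mult, <- Rpow_mult_distr; f_equal.
    replace (-1 * -1)%R with 1%R by ring; apply pow1. }
  assert (HJ : C_RInt (fun t => beta_chi q chi (S m) t lambda * Derive_n_on a b f (S m) t) a b
    = RtoC (INR (fact (S m))) * (RtoC ((-1) ^ m)
       * ((Psi (Int_part b) b - Psi (Int_part a) a + S0) - c * I0))).
  { apply (is_RInt_unique (V := C_R_CompleteNormedModule)).
    pose proof (is_RInt_minus (V := C_R_NormedModule) _ _ _ _ _ _ HI
      (is_CRInt_scal c _ _ _ _ HI0)) as H.
    apply (is_CRInt_scal (RtoC ((-1) ^ m))), (is_CRInt_scal (RtoC (INR (fact (S m))))) in H.
    eapply is_RInt_ext; [|exact H].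
    rewrite Rmin_left, Rmax_right by lra; intros x Hx; cbv beta.
    rewrite Hbeta, <- (HGf (S m)) by (lia || lra).
    change (minus ?u ?v) with (u - v).
    transitivity (RtoC (INR (fact (S m))) * (RtoC ((-1) ^ m) * RtoC ((-1) ^ m)
      * (w (S m) (Int_part x) x * G (S m) x))); [Cring|].
    rewrite Hsgn; Cring. }
  rewrite HJ.
  assert (HB : Csum (fun k => RtoC ((-1) ^ (k + 1) / INR (fact (k + 1))) *
         (beta_chi q chi (k + 1) b lambda * Derive_n_on a b f k b
          - beta_chi q chi (k + 1) a lambda * Derive_n_on a b f k a)) m
     = - (Psi (Int_part b) b - Psi (Int_part a) a)).
  { replace (- (Psi (Int_part b) b - Psi (Int_part a) a)) with
      (RtoC (-1) * Psi (Int_part b) b + RtoC 1 * Psi (Int_part a) a)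
      by (change (-1)%R with (- (1))%R; rewrite RtoC_opp; ring).
    unfold Psi; rewrite <- !Csum_scal_l.
    etransitivity; [|apply (sum_n_plus (G := C_AbelianMonoid))].
    apply sum_n_ext_loc; intros k Hk.
    rewrite Nat.add_1_r, !Hbeta, <- !HGf by (lia || lra).
    rewrite RtoC_div by apply INR_fact_neq_0; simpl pow; rewrite RtoC_mult.
    change (-1)%R with (- (1))%R at 1 3; rewrite RtoC_opp.
    match goal with |- ?u = plus ?v ?v' => change (u = v + v') end.
    field; apply fact_C_neq_0. }
  rewrite HB.
  replace (sum_Z_oc a b (fun k => chi k * Cpowz lambda (- k) * f (IZR k))) with S0.
  2:{ apply sum_Z_oc_ext; intros k Hk; unfold X; rewrite HGf by (lia || lra); reflexivity. }
  rewrite RtoC_div by apply INR_fact_neq_0.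
  set (F := RtoC (INR (fact (S m)))) in *.
  assert (HF : F <> 0) by apply fact_C_neq_0.
  set (V := Psi (Int_part b) b - Psi (Int_part a) a) in *.
  transitivity (- V + c * I0 + (RtoC ((-1) ^ m) * RtoC ((-1) ^ m)) * (V + S0 - c * I0)).
  - rewrite Hsgn; ring.
  - field; exact HF.
Qed.
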